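(* There are absolute constants $c_1,c_2>0$ such that for every integer $n'$ there exist an integer $n\ge n'$ and a set $X$ of $n$ points that is a permutation, such that $\mathrm{opt}(X)\ge c_1\, n\log\log n$ but $\mathrm{cGB}(X)\le c_2\, n\log\log\log n$.
   Context: Points have integer coordinates. Two points $p,q$ are collinear if $p.x=q.x$ or $p.y=q.y$; otherwise $\square_{p,q}$ is the smallest closed axis-parallel rectangle containing both. A non-collinear pair $(p,q)$ is satisfied in a set $S$ if some $r\in S\setminus\{p,q\}$ lies in $\square_{p,q}$; $S$ is satisfied if all its non-collinear pairs are satisfied in $S$. $X$ is a permutation if every horizontal line and every vertical line contains at most one point of $X$. $\mathrm{opt}(X)$ is the minimum $|Y|$ over point sets $Y$ with $X\cup Y$ satisfied. Consistent Guillotine bound: assume the $n$ points of $X$ have $x$-coordinates $\{1,\dots,n\}$ and $y$-coordinates $\{1,\dots,n\}$. Let $\mathcal L^V$ ($\mathcal L^H$) be the vertical (horizontal) lines with half-integral coordinate between $1/2$ and $n-1/2$, and $B$ a bounding box of $X$. For an ordering $\sigma$ of $\mathcal L^V\cup\mathcal L^H$, start with the partition $\mathcal P=\{B\}$ and process the lines in order; when line $L$ is processed, every rectangle $P\in\mathcal P$ intersecting $L$ is replaced by the two rectangles into which $L$ splits it, and the split of $P$ costs: if $L$ is vertical, the number of pairs of points of $X\cap P$ that are consecutive in increasing $y$-order and lie on opposite sides of $L$; if $L$ is horizontal, the number of pairs of points of $X\cap P$ consecutive in increasing $x$-order lying on opposite sides of $L$ (the cost is $0$ if $|X\cap P|\le1$).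 $\mathrm{cGB}_\sigma(X)$ is the total cost of all splits, and $\mathrm{cGB}(X)=\max_\sigma \mathrm{cGB}_\sigma(X)$. *)

(* Defs.v *)
From HB Require Import structures.
From mathcomp Require Import all_boot all_order all_algebra.
From Stdlib Require Import Reals.
From mathcomp Require Import Rstruct.
Set Implicit Arguments. Unset Strict Implicit. Unset Printing Implicit Defensive.
Import Order.TTheory GRing.Theory Num.Theory.
Local Open Scope ring_scope.

Definition point := (int * int)%type.

Definition collinear (p q : point) : bool := (p.1 == q.1) || (p.2 == q.2).

Definition in_box (p q r : point) : bool :=
  (Num.min p.1 q.1 <= r.1 <= Num.max p.1 q.1) &&
  (Num.min p.2 q.2 <= r.2 <= Num.max p.2 q.2).

Definition pair_satisfied (S : seq point) (p q : point) : bool :=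
  has (fun r => [&& r != p, r != q & in_box p q r]) S.

Definition satisfied (S : seq point) : bool :=
  all (fun p => all (fun q => collinear p q || pair_satisfied S p q) S) S.

Definition perm_points (X : seq point) (n : nat) : Prop :=
  perm_eq (map fst X) [seq (i%:Z) | i <- iota 1 n] /\
  perm_eq (map snd X) [seq (i%:Z) | i <- iota 1 n].

Definition is_opt (X : seq point) (m : nat) : Prop :=
  (exists Y : seq point, size (undup Y) = m /\ satisfied (X ++ Y)) /\
  (forall Y : seq point, satisfied (X ++ Y) -> leq m (size (undup Y))).

(* Lines: (true, k) is the vertical line x = k + 1/2, (false, k) the horizontal
   line y = k + 1/2; the lines of L^V ∪ L^H for n points have k = 0..n-1. *)
Definition line := (bool * int)%type.
Definition lines (n : nat) : seq line :=
  [seq (true, i%:Z) | i <- iota 0 n] ++ [seq (false, i%:Z) | i <- iota 0 n].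

(* A rectangle ((xlo,xhi),(ylo,yhi)) stands for the real rectangle
   [xlo - 1/2, xhi + 1/2] x [ylo - 1/2, yhi + 1/2]. *)
Definition rect := ((int * int) * (int * int))%type.

Definition in_rect (P : rect) (p : point) : bool :=
  (P.1.1 <= p.1 <= P.1.2) && (P.2.1 <= p.2 <= P.2.2).

Definition crosses (L : line) (P : rect) : bool :=
  if L.1 then (P.1.1 <= L.2) && (L.2 < P.1.2)
  else (P.2.1 <= L.2) && (L.2 < P.2.2).

Definition split_rect (L : line) (P : rect) : seq rect :=
  if L.1 then [:: ((P.1.1, L.2), P.2); ((L.2 + 1, P.1.2), P.2)]
  else [:: (P.1, (P.2.1, L.2)); (P.1, (L.2 + 1, P.2.2))].

Definition opp_pairs (side : point -> bool) (s : seq point) : nat :=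
  count (fun ab : point * point => side ab.1 != side ab.2) (zip s (behead s)).

Definition split_cost (X : seq point) (L : line) (P : rect) : nat :=
  let pts := [seq p <- X | in_rect P p] in
  if L.1 then
    opp_pairs (fun p => p.1 <= L.2) (sort (fun p q : point => p.2 <= q.2) pts)
  else
    opp_pairs (fun p => p.2 <= L.2) (sort (fun p q : point => p.1 <= q.1) pts).

Definition gstep (X : seq point) (st : seq rect * nat) (L : line) : seq rect * nat :=
  (flatten [seq if crosses L P then split_rect L P else [:: P] | P <- st.1],
   addn st.2 (sumn [seq split_cost X L P | P <- st.1 & crosses L P])).

Definition bbox (n : nat) : rect := ((1, n%:Z), (1, n%:Z)).

Definition cGB_sigma (X : seq point) (sigma : seq line) : nat :=
  (foldl (gstep X) ([:: bbox (size X)], 0%N) sigma).2.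

Definition cGB (X : seq point) : nat :=
  \max_(sigma <- permutations (lines (size X))) cGB_sigma X sigma.

(* Main.v *)
Require Import Defs.
From Stdlib Require Import Reals Lra.
From mathcomp Require Import Rstruct.
From mathcomp Require Import all_boot all_order all_algebra.
From mathcomp Require Import boolp zify.
Set Implicit Arguments. Unset Strict Implicit. Unset Printing Implicit Defensive.

(** With N = 2^q and M = 2^N, take an M x M array of blocks; block (i, j) holds a
    copy of the bit-reversal permutation on N points whose columns and rows are
    exponentially spaced, shifted by i horizontally and by j vertically: point k
    sits in column 2^(k+1) + i and row 2^(rev k + 1) + j of its block. Points in
    a common column or row are separated in increasing order. Each block is a
    bit-reversal permutation and satisfied supersets restrict to blocks, so
    opt(X) is of order n log N, that is, n log log n.

    For a consistent ordering, the vertical (horizontal) cuts cost no more than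
    they would without the horizontal (vertical) ones, so it suffices to count
    alternations: triples (m, l, r) such that l and r are in the slab split by the
    line m, on opposite sides, and consecutive in y-order within the slab. There
    are only O(n) of them, whatever the order of the cuts. Inside one block this
    is because a line m at distance about 2^a from the origin i of the block
    costs min(left, right) only if its slab contains the points of exponents a-t,
    ..., a+1+t; assigning such an alternation to the scale a + t around the column
    of the point of exponent a-1, each scale around each column is used O(1) times.
    Between blocks, moving i (or j) to its successor moves every point by one
    step only, so a side change is due to a point entering or leaving the slab
    or to a family of points that is already split by m. *)

(** * Alternations along a sequence of vertical cuts *)

Section AtMost.
Local Open Scope nat_scope.
Variable E : eqType.

(** Phrased with duplicate-free lists so that [D] can be an arbitrary proposition. *)
Definition at_most (D : E -> Prop) (c : nat) : Prop :=
  forall s : seq E, uniq s -> (forall e, e \in s -> D e) -> size s <= c.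

Lemma at_most_sub (D D' : E -> Prop) c :
  (forall e, D e -> D' e) -> at_most D' c -> at_most D c.
Proof. by move=> sub h s us hs; apply: h => // e /hs /sub. Qed.

Lemma at_most_le (D : E -> Prop) c c' : at_most D c -> c <= c' -> at_most D c'.
Proof. by move=> h le s us hs; apply: leq_trans (h s us hs) le. Qed.

Lemma at_most_or (D1 D2 : E -> Prop) c1 c2 :
  at_most D1 c1 -> at_most D2 c2 -> at_most (fun e => D1 e \/ D2 e) (c1 + c2).
Proof.
move=> h1 h2 s us hs.
rewrite -(count_predC (fun e => `[< D1 e >]) s) -!size_filter; apply: leq_add.
  by apply: h1; [rewrite filter_uniq | move=> e; rewrite mem_filter => /andP[/asboolP]].
apply: h2; first by rewrite filter_uniq.
move=> e; rewrite mem_filter => /andP[/= /asboolP nD1 /hs]; tauto.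
Qed.

(** The charging principle: choice turns [R] into an injective map to tokens. A relation is used
    because a token may depend on existential witnesses. *)
Lemma at_most_token (tok : finType) (R : E -> tok -> Prop) (D : E -> Prop) :
  (forall e, D e -> exists t, R e t) ->
  (forall e e' t, D e -> D e' -> R e t -> R e' t -> e = e') ->
  at_most D #|tok|.
Proof.
move=> ex inj s us hs.
case: (pselect (inhabited tok)) => [[t0]|none]; last first.
  by case: s us hs => // e s _ /(_ e (mem_head _ _)) /ex [t _]; case: none.
have /choice[f hf] : forall e, exists t, D e -> R e t.
  move=> e; case: (pselect (D e)) => [/ex[t ht]|nD]; first by exists t.
  by exists t0.
have inj_f : {in s &, injective f}.
  move=> e e' es e's ff; have De := hs e es; have De' := hs e' e's.
  by apply: (inj _ _ (f e)) => //; [exact: hf | rewrite ff; exact: hf].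
rewrite -(size_map f) -(card_uniqP _) ?map_inj_in_uniq //; exact: max_card.
Qed.

End AtMost.

Section Alternations.
Local Open Scope nat_scope.
Variables (T : finType) (x y pr : T -> nat).
Hypotheses (xI : injective x) (yI : injective y) (prI : injective pr).

(* An element [m] also stands for the vertical line just to the right of the
   point [m]; lines are cut by increasing [pr], and [cell m p] says that [p]
   lies in the slab that is split by the line [m]. *)
Definition cell (m p : T) : Prop :=
  forall z, (x p <= x z < x m) || (x m < x z < x p) -> pr m < pr z.

Lemma cell_self m : cell m m.
Proof. move=> z; lia. Qed.

Lemma cell_convex m p q r : cell m p -> cell m q -> x p <= x r <= x q -> cell m r.
Proof.
move=> hp hq hr z hz; case: (leqP (x r) (x m)) => h.
  by apply: hp; lia.
by apply: hq; lia.
Qed.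

Lemma cell_line m p q m' :
  cell m p -> cell m q -> x p <= x m' < x q -> pr m <= pr m'.
Proof.
move=> hp hq hm'; case: (ltngtP (x m') (x m)) => h.
- by apply/ltnW/hp; lia.
- by apply/ltnW/hq; lia.
- by rewrite (xI h).
Qed.

(** Each of the two lines is the earliest one between [l] and [r]. *)
Lemma cell_sep m m' l r :
  cell m l -> cell m r -> x l <= x m < x r ->
  cell m' l -> cell m' r -> x l <= x m' < x r -> m = m'.
Proof.
move=> a b c a' b' c'; apply: prI; apply/eqP; rewrite eqn_leq.
by rewrite (cell_line a b c') (cell_line a' b' c).
Qed.

(** When the later line [m'] is processed, [m] is already drawn, so the slab of [m'] lies on one
    side of it. *)
Lemma cell_side m m' p r :
  cell m p -> cell m' p -> cell m' r -> pr m < pr m' ->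
  (x p <= x m) = (x r <= x m).
Proof.
move=> h1 h2 h3 lt; apply/idP/idP => h; rewrite leqNgt; apply/negP => h'.
  by have := @cell_line m' p r m h2 h3; rewrite h h' => /(_ isT); lia.
by have := @cell_line m' r p m h3 h2; rewrite h h' => /(_ isT); lia.
Qed.

Lemma line_eq_wlog (P : T -> T -> Prop) :
  (forall m m', P m m' -> P m' m) ->
  (forall m m', P m m' -> pr m < pr m' -> False) ->
  forall m m', P m m' -> m = m'.
Proof.
move=> sP hP m m' h; apply: prI; apply/eqP.
by case: ltngtP => // lt; [case: (hP _ _ h lt) | case: (hP _ _ (sP _ _ h) lt)].
Qed.

Definition consecutive (m l r : T) : Prop :=
  forall z, cell m z -> ~ (y l < y z < y r) /\ ~ (y r < y z < y l).

(** The flag [b] tells rising pairs, with the left point below, from falling ones; the grid treats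
    the two differently. *)
Definition alternation (b : bool) (e : T * T * T) : Prop :=
  let: (m, l, r) := e in
  [/\ cell m l, cell m r, x l <= x m < x r,
      (if b then y l < y r else y r < y l) & consecutive m l r].

Lemma alternation_right b m l r r' :
  alternation b (m, l, r) -> alternation b (m, l, r') -> r = r'.
Proof.
move=> [_ cr _ hb co] [_ cr' _ hb' co']; apply: yI.
by case: b hb hb' => hb hb'; have := co _ cr'; have := co' _ cr; lia.
Qed.

Lemma alternation_left b m l l' r :
  alternation b (m, l, r) -> alternation b (m, l', r) -> l = l'.
Proof.
move=> [cl _ _ hb co] [cl' _ _ hb' co']; apply: yI.
by case: b hb hb' => hb hb'; have := co _ cl'; have := co' _ cl; lia.
Qed.

Lemma alternation_line b m m' l r :
  alternation b (m, l, r) -> alternation b (m', l, r) -> m = m'.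
Proof. move=> [? ? ? _ _] [? ? ? _ _]; exact: (@cell_sep m m' l r). Qed.

(** * Alternations between the classes of a partition into intervals *)

Section Classes.
Variable cls : T -> nat.
Hypothesis cls_mono : forall p q, x p <= x q -> cls p <= cls q.

(** Charged to [l]: if [l] also served a later line [m'], the slab of [m'] would lie to the left of
    [m], so [r'] could not leave the class of [l]. *)
Lemma at_most_left_class b :
  at_most (fun e => alternation b e /\ cls e.1.2 < cls e.2 /\ cls e.1.1 = cls e.1.2) #|T|.
Proof.
apply: (@at_most_token _ _ (fun e t => t = e.1.2)); first by move=> e _; exists e.1.2.
move=> [[m l] r] [[m' l'] r'] t /= [a [c d]] [a' [c' d']] ->{t} ll'; subst l'.
suff mm : m = m' by subst m'; rewrite (alternation_right a a').
pose P m m' := (exists r, alternation b (m, l, r) /\ cls l < cls r /\ cls m = cls l) /\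
  (exists r, alternation b (m', l, r) /\ cls l < cls r /\ cls m' = cls l).
apply: (@line_eq_wlog P); first by move=> ? ? [].
  move=> {}m {}m' [[{}r [{}a [{}c {}d]]] [{}r' [{}a' [{}c' {}d']]]] lt.
  have [cl cr sr _ _] := a; have [cl' cr' sr' _ _] := a'.
  have := cell_side cl cl' cr' lt; case/andP: sr => -> _ /esym /cls_mono; lia.
by split; [exists r | exists r'].
Qed.

Lemma at_most_right_class b :
  at_most (fun e => alternation b e /\ cls e.1.2 < cls e.2 /\ cls e.1.1 = cls e.2) #|T|.
Proof.
apply: (@at_most_token _ _ (fun e t => t = e.2)); first by move=> e _; exists e.2.
move=> [[m l] r] [[m' l'] r'] t /= [a [c d]] [a' [c' d']] ->{t} rr'; subst r'.
suff mm : m = m' by subst m'; rewrite (alternation_left a a').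
pose P m m' := (exists l, alternation b (m, l, r) /\ cls l < cls r /\ cls m = cls r) /\
  (exists l, alternation b (m', l, r) /\ cls l < cls r /\ cls m' = cls r).
apply: (@line_eq_wlog P); first by move=> ? ? [].
  move=> {}m {}m' [[{}l [{}a [{}c {}d]]] [{}l' [{}a' [{}c' {}d']]]] lt.
  have [cl cr sr _ _] := a; have [cl' cr' sr' _ _] := a'.
  have := cell_side cr cr' cl' lt.
  have : x m <= x l' -> cls m <= cls l' by exact: cls_mono.
  lia.
by split; [exists l | exists l'].
Qed.

(** Each slab extends beyond the common class on both sides, so it contains the other line; as a
    slab is split by its earliest line, neither precedes the other. *)
Lemma class_line_inj m m' l r l' r' :
  cell m l -> cell m r -> x l <= x m < x r -> cls l < cls m < cls r ->
  cell m' l' -> cell m' r' -> x l' <= x m' < x r' -> cls l' < cls m' < cls r' ->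
  cls m = cls m' -> m = m'.
Proof.
move=> cl cr sr hc cl' cr' sr' hc' e.
pose P m m' := exists l r l' r', [/\ cell m l, cell m r, x l <= x m < x r & cls l < cls m < cls r]
  /\ [/\ cell m' l', cell m' r', x l' <= x m' < x r', cls l' < cls m' < cls r' & cls m = cls m'].
apply: (@line_eq_wlog P); last by exists l, r, l', r'.
  move=> a a' [b [c [d [f [[? ? ? ?] [? ? ? ? ?]]]]]]; exists d, f, b, c; do !split=> //; lia.
move=> {l r l' r' cl cr sr hc cl' cr' sr' hc' e m m'} m m'.
move=> [l [r [l' [r' [[cl cr sr hc] [cl' cr' sr' hc' e]]]]]] lt.
have := @cell_line m' l' r' m cl' cr'.
have := @cls_mono m l'; have := @cls_mono r' m; lia.
Qed.
End Classes.

(** * Lines that split a family of points *)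

Section Branch.
Variables (L : eqType) (f : T -> L).

(** These lines are the branching nodes of the tree of cuts restricted to the points of label [c],
    hence fewer than these points. *)
Definition branch (m : T) (c : L) : Prop :=
  exists a z, [/\ f a = c, f z = c, cell m a, cell m z & x a <= x m < x z].

Definition last_left (e : T * L) (t : T) : Prop :=
  [/\ branch e.1 e.2, f t = e.2, cell e.1 t, x t <= x e.1 &
   forall a, f a = e.2 -> cell e.1 a -> x a <= x e.1 -> x a <= x t].

Lemma last_left_ex m c : branch m c -> exists t, last_left (m, c) t.
Proof.
move=> h; have [a0 [z [fa fz ca cz h0]]] := h.
pose P a := `[< [/\ f a = c, cell m a & x a <= x m] >].
have Pa0 : P a0 by apply/asboolP; split=> //; lia.
case: (arg_maxnP x Pa0) => t /asboolP[ft ct lt] tmax; exists t; split=> // a fa' ca' la'.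
by apply: tmax; apply/asboolP.
Qed.

(** If [m] is cut first, the slab of [m'] lies to the left of [m], so a point [z] of label [c] to
    the right of [m'] is between [t] and [m], against the choice of [t]. *)
Lemma last_left_inj e e' t : last_left e t -> last_left e' t -> e = e'.
Proof.
case: e e' => [m c] [m' c'] h h'.
have cc : c' = c by case: h h' => _ /= <- _ _ _ [_ /= <-].
subst c'; congr (_, _).
pose P m m' := last_left (m, c) t /\ last_left (m', c) t.
apply: (@line_eq_wlog P) => [? ? []|{h h'}{}m {}m' [h h'] lt|] //.
have [_ _ ct lm tmax] := h; have [/= [a [z [fa fz ca cz sz]]] _ /= ct' lm' _] := h'.
rewrite /= in ct lm tmax lm'.
have := cell_side ct ct' cz lt; rewrite lm => /esym zm.
have cz' : cell m z by apply: (cell_convex ct (@cell_self m)); lia.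
by have := tmax z fz cz' zm; lia.
Qed.

Lemma at_most_branch (g : T * T * T -> L) (D : T * T * T -> Prop) :
  (forall e, D e -> branch e.1.1 (g e)) ->
  (forall e e', D e -> D e' -> e.1.1 = e'.1.1 -> g e = g e' -> e = e') ->
  at_most D #|T|.
Proof.
move=> hb inj; apply: (@at_most_token _ _ (fun e t => last_left (e.1.1, g e) t)).
  by move=> e /hb /last_left_ex.
by move=> e e' t De De' h /(last_left_inj h) [? ?]; apply: inj.
Qed.
End Branch.
End Alternations.

Arguments alternation : simpl never.

(** * Alternations of the shifted exponential grid *)

Section GridBound.
Local Open Scope nat_scope.
Variables (T : finType) (x y pr ti tj tk B : T -> nat) (M N : nat).
Hypotheses (xI : injective x) (yI : injective y) (prI : injective pr).
Hypotheses (ti_lt : forall p, ti p < M) (tj_lt : forall p, tj p < M)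
  (tk_lt : forall p, tk p < N) (leM : 2 ^ N <= M).
Hypothesis point_ex : forall a b c, a < M -> b < M -> c < N ->
  exists p, [/\ ti p = a, tj p = b & tk p = c].
Hypothesis point_eq : forall p q, ti p = ti q -> tj p = tj q -> tk p = tk q -> p = q.
(* [B] stands for the row offset: exchanging the coordinates makes it the
   offset [2 ^ (tk p).+1] composed with a permutation of the exponents. *)
Hypothesis B_eq : forall p q, (B p == B q) = (tk p == tk q).

Let u p := 2 ^ (tk p).+1 + ti p.
Let v p := B p + tj p.

Hypothesis xlex : forall p q, x p < x q <->
  tj p < tj q \/ tj p = tj q /\ (u p < u q \/ u p = u q /\ ti p < ti q).
Hypothesis ylex : forall p q, y p < y q <->
  ti p < ti q \/ ti p = ti q /\ (v p < v q \/ v p = v q /\ tj p < tj q).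

Local Notation alt := (alternation x y pr).
Local Notation cl := (cell x pr).

Let u_lt p : u p < M * 2.
Proof.
have : 2 ^ (tk p).+1 <= 2 ^ N by rewrite leq_exp2l.
by rewrite /u; have := ti_lt p; lia.
Qed.

(** * Alternations inside one block *)

Let block_order p q : ti p = ti q -> tj p = tj q -> (x p < x q) = (tk p < tk q).
Proof.
move=> ei ej; have e : (2 ^ (tk p).+1 < 2 ^ (tk q).+1) = (tk p < tk q).
  by rewrite ltn_exp2l.
rewrite -e; apply/idP/idP => [/xlex|h]; first by rewrite /u; lia.
by apply/xlex; rewrite /u; lia.
Qed.

(* The points [a] and [b] of exponents [e] and [e + 1] of a block enclose [m]. *)
Let straddle m a b := [/\ cl m a, cl m b, x a <= x m < x b, ti a = ti b &
  tj a = tj b /\ tk b = (tk a).+1].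

(** The exponent of [l] is raised step by step until the line is passed. *)
Let straddle_ex m l r : cl m l -> cl m r -> x l <= x m < x r -> ti l = ti r ->
  tj l = tj r -> exists a b, [/\ straddle m a b, ti a = ti l, tj a = tj l, tk l <= tk a & tk b <= tk r].
Proof.
move=> cml cmr s ei ej; have : tk l < tk r by rewrite -block_order //; lia.
move eqd : (tk r - tk l) => d; elim: d l cml s ei ej eqd => [|d IH] l cml s ei ej ed lt.
  lia.
case: (ltngtP (tk r) (tk l).+1) => h; first lia; last first.
  by exists l, r; split=> //; lia.
have [c [ci cj ck]] : exists c, [/\ ti c = ti l, tj c = tj l & tk c = (tk l).+1].
  by apply: point_ex => //; apply: ltn_trans h (tk_lt r).
have xlc : x l < x c by rewrite block_order ?ci ?cj //; lia.
have xcr : x c < x r by rewrite block_order ?ci ?cj ?ck.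
have cmc : cl m c by apply: (cell_convex cml cmr); lia.
case: (leqP (x c) (x m)) => hc.
  have [a [b [st ai aj ka kb]]] : exists a b,
      [/\ straddle m a b, ti a = ti c, tj a = tj c, tk c <= tk a & tk b <= tk r].
    by apply: IH => //; lia.
  by exists a, b; split=> //; lia.
by exists l, c; split=> //; [split=> //; lia | lia].
Qed.

Let straddle_line m m' a b b' : straddle m a b -> straddle m' a b' -> m = m'.
Proof.
move=> [ca cb s ei [ej ek]] [ca' cb' s' ei' [ej' ek']].
have eb : b = b' by apply: point_eq; lia.
subst b'; exact: (cell_sep xI prI ca cb s ca' cb' s').
Qed.

Let straddle_u m a b : straddle m a b -> tj m = tj a /\ u a <= u m <= u b.
Proof.
move=> [_ _ s _ [ej _]].
have := xlex m b; have := xlex m a; lia.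
Qed.

(** In the block of [a], [U] is the column of the exponent just below that of [a], and the slab
    reaches the column of exponent [s.+1]. *)
Let scale m j U s := exists a b z f,
  [/\ straddle m a b, cl m z, cl m f & tj a = j] /\
  [/\ tj z = j, tj f = j, u z = U, U = 2 ^ tk a + ti a &
  u f = 2 ^ s.+2 + ti a /\ (tk a).+1 <= s].

(* The slab of [m] reaches at least [2 ^ s.+1] to the right of [m], and [U] is
   within [3 * 2 ^ s.-1] to its left: of two such lines, each would have to be cut
   before the other. *)
Let scale_line m m' j U s : scale m j U s -> scale m' j U s -> m = m'.
Proof.
wlog: m m' / x m' < x m => [wl|lt].
  move=> h h'; case: (ltngtP (x m) (x m')) => [lt|lt|/xI //]; last exact: wl.
  by apply/esym/wl.
move=> [a [b [z [f [[st cz cf ja] [jz jf uz eU [uf ls]]]]]]].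
move=> [a' [b' [z' [f' [[st' cz' cf' ja'] [jz' jf' uz' eU' [uf' ls']]]]]]].
have [jm um] := straddle_u st; have [jm' um'] := straddle_u st'.
have [_ _ _ ei [ej ek]] := st; have [_ _ _ ei' [ej' ek']] := st'.
have p1 : 2 ^ (tk a).+1 <= 2 ^ s by rewrite leq_exp2l.
have p1' : 2 ^ (tk a').+1 <= 2 ^ s by rewrite leq_exp2l.
have p0 : 0 < 2 ^ tk a by rewrite expn_gt0.
have p0' : 0 < 2 ^ tk a' by rewrite expn_gt0.
(* The line [m] is at most [3 * 2 ^ tk a] beyond [U], whereas [f'] is [4 * 2 ^ s - 2 ^ tk a'] beyond
   it; [m'] is to the right of [U] because [a'] is. *)
have [lu uu'] : u m < u f' /\ u z < u m'.
  have ub : u b = 2 * (2 * 2 ^ tk a) + ti a by rewrite /u ek !expnS ei.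
  have ua' : u a' = 2 * 2 ^ tk a' + ti a' by rewrite /u expnS.
  rewrite !expnS in p1 p1'; move: um um'; rewrite uf' uz ub ua' !expnS.
  move: eU' p0 p0' p1 p1'; rewrite eU.
  move: (u m) (u a) (u m') (u b') (2 ^ tk a) (2 ^ tk a') (2 ^ s) (ti a) (ti a').
  clear; lia.
have h1 : x m < x f' by apply/xlex; right; split; [congruence | left].
have h2 : x z < x m' by apply/xlex; right; split; [congruence | left].
have l1 : pr m' <= pr m by apply: (cell_line xI (@cell_self _ x pr m') cf'); lia.
have l2 : pr m <= pr m' by apply: (cell_line xI cz (@cell_self _ x pr m)); lia.
by apply: prI; lia.
Qed.

(** With [k] the exponent of [a], the line is between [2 ^ k] and [3 * 2 ^ k] beyond the common
    column. This leaves at most two consecutive values of [k], told apart by parity. *)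
Let scale_depth m a b a' b' : straddle m a b -> straddle m a' b' ->
  2 ^ tk a + ti a = 2 ^ tk a' + ti a' -> odd (tk a) = odd (tk a') -> tk a = tk a'.
Proof.
wlog lt : a a' b b' / tk a < tk a' => [wl st st' e o|].
  by case: (ltngtP (tk a) (tk a')) => // lt; [exact: (wl a a' b b') | apply/esym/(wl a' a b' b)].
move=> st st' e o.
have [_ um] := straddle_u st; have [_ um'] := straddle_u st'.
have [_ _ _ ei [ej ek]] := st; have [_ _ _ ei' [ej' ek']] := st'.
have lt2 : (tk a).+2 <= tk a' by lia.
have : 2 ^ (tk a).+2 <= 2 ^ tk a' by rewrite leq_exp2l.
have p0 : 0 < 2 ^ tk a by rewrite expn_gt0.
have um1 : u m = 2 * 2 ^ tk m + ti m by rewrite /u expnS.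
rewrite /u ek ek' !expnS in um um' *; lia.
Qed.

(** One end belongs to the straddling pair, which determines the line; the flag tells which end. *)
Let same_block_near b : at_most (fun e => alt b e /\ exists a c,
  [/\ straddle e.1.1 a c, ti a = ti e.1.2, tj a = tj e.1.2, ti a = ti e.2 & tj a = tj e.2] /\
  (tk e.1.2 = tk a \/ tk e.2 = tk c)) (#|T| * 2).
Proof.
have -> : #|T| * 2 = #|{: T * bool}| by rewrite card_prod card_bool.
apply: (@at_most_token _ _ (fun e t => exists c, straddle e.1.1 t.1 c /\
  if t.2 then e.1.2 = t.1 else e.2 = c)).
  move=> [[m l] r] /= [al [a [c [[st ai aj ai' aj'] [k|k]]]]].
    by exists (a, true), c; split=> //=; apply: point_eq.
  exists (a, false), c; split=> //=; case: st => [_ _ _ ei [ej ek]].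
  by apply: point_eq; lia.
move=> [[m l] r] [[m' l'] r'] [a tag] /= [al _] [al' _] [c [st e]] [c' [st' e']].
have mm := straddle_line st st'; subst m'.
have cc : c = c'.
  by case: st st' => [_ _ _ ei [ej ek]] [_ _ _ ei' [ej' ek']]; apply: point_eq; lia.
subst c'; case: tag e e' => ??; subst.
  by rewrite (alternation_right yI al al').
by rewrite (alternation_left yI al al').
Qed.

(** By [scale_line], block column, [U] and scale give the line; parity then gives the straddling
    pair, and the last bit tells which end is exactly [t] exponents away from it. *)
Let same_block_far b : at_most (fun e => alt b e /\ exists a c,
  [/\ straddle e.1.1 a c, ti a = ti e.1.2, tj a = tj e.1.2, ti a = ti e.2 & tj a = tj e.2] /\
  (tk e.1.2 < tk a /\ tk c < tk e.2)) (M * (M * 2) * N * 4).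
Proof.
have -> : M * (M * 2) * N * 4 = #|{: 'I_M * 'I_(M * 2) * 'I_N * (bool * bool)}|.
  by rewrite !card_prod !card_ord card_bool.
(* The slab contains [t] further exponents on either side of the straddling pair, and [t] is
   positive here, so [z] and [f] exist. *)
pose t (a c l r : T) := minn (tk a - tk l) (tk r - tk c).
pose R (e : T * T * T) (w : 'I_M * 'I_(M * 2) * 'I_N * (bool * bool)) := exists a c,
  [/\ straddle e.1.1 a c, ti a = ti e.1.2, tj a = tj e.1.2, ti a = ti e.2 & tj a = tj e.2] /\
  [/\ (tk e.1.2 < tk a /\ tk c < tk e.2), w.1.1.1 = tj a :> nat, w.1.1.2 = 2 ^ tk a + ti a :> nat,
   w.1.2 = tk a + t a c e.1.2 e.2 :> nat & w.2.1 = odd (tk a) /\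
   w.2.2 = (tk a - tk e.1.2 <= tk e.2 - tk c)].
apply: (@at_most_token _ _ R).
  move=> [[m l] r] /= [al [a [c [h [k1 k2]]]]].
  have hU : 2 ^ tk a + ti a < M * 2.
    have : 2 ^ (tk a) <= 2 ^ N by rewrite leq_exp2l // ltnW.
    by have := ti_lt a; lia.
  have hs : tk a + t a c l r < N.
    by case: h => [[_ _ _ _ [_ ck]] _ _ _ _]; have := tk_lt r; rewrite /t; lia.
  exists (Ordinal (tj_lt a), Ordinal hU, Ordinal hs, (odd (tk a), tk a - tk l <= tk r - tk c)).
  by exists a, c; split.
have sc m l r a c : cl m l -> cl m r -> straddle m a c -> ti a = ti l -> tj a = tj l ->
    ti a = ti r -> tj a = tj r -> tk l < tk a -> tk c < tk r ->
    scale m (tj a) (2 ^ tk a + ti a) (tk a + t a c l r).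
  move=> cml cmr st ai aj ai' aj' k1 k2; have [_ _ _ ei [ej ek]] := st.
  have [z [zi zj zk]] : exists z, [/\ ti z = ti a, tj z = tj a & tk z = (tk a).-1].
    by apply: point_ex => //; apply: leq_ltn_trans (leq_pred _) (tk_lt a).
  have [f [fi fj fk]] : exists f, [/\ ti f = ti a, tj f = tj a & tk f = (tk a + t a c l r).+1].
    by apply: point_ex => //; apply: leq_ltn_trans (tk_lt r); rewrite /t; lia.
  have cin p : ti p = ti a -> tj p = tj a -> tk l <= tk p <= tk r -> cl m p.
    move=> pi pj /andP[lp pr']; apply: (cell_convex cml cmr).
    rewrite (leqNgt (x l)) (leqNgt (x p)) !block_order ?pi ?pj //.
    by rewrite -!leqNgt lp pr'.
  exists a, c, z, f; split; split=> //.
  - by apply: cin => //; rewrite zk; lia.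
  - by apply: cin => //; rewrite fk /t; lia.
  - by rewrite /u zk zi prednK //; lia.
  - by rewrite /u fk fi; split=> //; rewrite /t; lia.
move=> [[m l] r] [[m' l'] r'] [[[J U] S] [par tag]] /= [al _] [al' _].
move=> [a [c [[st ai aj ai' aj'] [[k1 k2] eJ eU eS [ep et]]]]].
move=> [a' [c' [[st' bi bj bi' bj'] [[k1' k2'] eJ' eU' eS' [ep' et']]]]].
rewrite /= in st ai aj ai' aj' k1 k2 eJ eU eS ep et st' bi bj bi' bj' k1' k2' eJ' eU' eS' ep' et'.
have mm : m = m'.
  have [cml cmr _ _ _] := al; have [cml' cmr' _ _ _] := al'.
  have := sc _ _ _ _ _ cml cmr st ai aj ai' aj' k1 k2; rewrite -eJ -eU -eS => h.
  have := sc _ _ _ _ _ cml' cmr' st' bi bj bi' bj' k1' k2'; rewrite -eJ' -eU' -eS' => h'.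
  exact: scale_line h h'.
subst m'; have ek : tk a = tk a' by apply: (scale_depth st st'); congruence.
have aa : a = a' by apply: point_eq => //; [rewrite ek in eU; lia | congruence].
subst a'; have cc : c = c'.
  by case: st st' => [_ _ _ ? [? ?]] [_ _ _ ? [? ?]]; apply: point_eq; lia.
subst c'; rewrite /t in eS eS'; case: tag et et' => et et'.
  have ll : l = l' by apply: point_eq; lia.
  by subst l'; rewrite (alternation_right yI al al').
have rr : r = r' by apply: point_eq; lia.
by subst r'; rewrite (alternation_left yI al al').
Qed.

Let same_block b : at_most (fun e => alt b e /\ ti e.1.2 = ti e.2 /\ tj e.1.2 = tj e.2)
  (#|T| * 2 + M * (M * 2) * N * 4).
Proof.
apply: (at_most_sub _ (at_most_or (@same_block_near b) (@same_block_far b))).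
move=> [[m l] r] /= [al [ei ej]]; have [cml cmr s _ _] := al.
have [a [c [st ai aj k1 k2]]] := straddle_ex cml cmr s ei ej.
case: (boolP ((tk l == tk a) || (tk r == tk c))) => h; [left|right]; split=> //; exists a, c; split.
- by split=> //; congruence.
- by lia.
- by split=> //; congruence.
- by lia.
Qed.

(** * Alternations inside one block row *)

Let tj_mono p q : x p <= x q -> tj p <= tj q.
Proof. by move=> h; have := xlex q p; lia. Qed.

(** Numbers all columns from left to right; by [u_lt] a block column has width at most [M * 2]. *)
Let col p := tj p * (M * 2) + u p.

Let col_lt p q : (col p < col q) = (tj p < tj q) || (tj p == tj q) && (u p < u q).
Proof.
have up := u_lt p; have uq := u_lt q; rewrite /col.
case: (ltngtP (tj p) (tj q)) => [h|h|->] /=.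
- have : (tj p).+1 * (M * 2) <= tj q * (M * 2) by rewrite leq_mul2r h orbT.
  by rewrite mulSn; move: (tj p * _) (tj q * _); lia.
- have : (tj q).+1 * (M * 2) <= tj p * (M * 2) by rewrite leq_mul2r h orbT.
  by rewrite mulSn; move: (tj p * _) (tj q * _); lia.
- by rewrite ltn_add2l.
Qed.

Let col_mono p q : x p <= x q -> col p <= col q.
Proof. by move=> h; rewrite leqNgt col_lt; have := xlex q p; lia. Qed.

(* [p], the copy of [l] in the next block column, lies between [l] and [r]
   horizontally; as it does not separate them in [y], [l] and [r] share a row. *)
Let same_row_up : at_most (fun e => alt true e /\ ti e.1.2 = ti e.2 /\
  tj e.1.2 < tj e.1.1 < tj e.2) #|T|.
Proof.
have key m l r : alt true (m, l, r) -> ti l = ti r -> tj l < tj m < tj r -> v r = v l.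
  move=> [cml cmr s lt co] ei hj.
  have [p [pi pj pk]] : exists p, [/\ ti p = ti l, tj p = (tj l).+1 & tk p = tk l].
    by apply: point_ex => //; have := tj_lt r; lia.
  have eB : B p = B l by apply/eqP; rewrite B_eq pk.
  have cp : cl m p by apply: (cell_convex cml cmr); have := xlex l p; have := xlex p r; lia.
  have [co1 _] := co p cp.
  have np : y p <> y r by move=> /yI e; move: hj; rewrite -e; lia.
  by move: (ylex l r) (ylex l p) (ylex r p); rewrite /v; lia.
apply: (@at_most_token _ _ (fun e t => t = e.1.2)); first by move=> e _; exists e.1.2.
move=> [[m l] r] [[m' l'] r'] t /= [al [ei hj]] [al' [ei' hj']] -> ll; subst l'.
have vr := key _ _ _ al ei hj; have vr' := key _ _ _ al' ei' hj'.
have [cml cmr s lt co] := al; have [cml' cmr' s' lt' co'] := al'.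
(* Both lie in the row of [l], so the nearer one would come between [l] and the other. *)
have rr : r = r'.
  case: (ltngtP (tj r) (tj r')) => h.
  - have cr : cl m' r by apply: (cell_convex cml' cmr'); have := xlex l r; have := xlex r r'; lia.
    by have := co' _ cr; have := ylex r r'; lia.
  - have cr : cl m r' by apply: (cell_convex cml cmr); have := xlex l r'; have := xlex r' r; lia.
    by have := co _ cr; have := ylex r' r; lia.
  - by apply: yI; have := ylex r r'; have := ylex r' r; lia.
by subst r'; rewrite (alternation_line xI prI al al').
Qed.

(** The block column of [m] gives the line, and [r] is the last point in the slab with its block row
    and exponent. *)
Let same_row_exit : at_most (fun e => [/\ alt false e, ti e.1.2 = ti e.2,
  tj e.1.2 < tj e.1.1 < tj e.2 & forall p, ti p = ti e.2 -> tj p = (tj e.2).+1 ->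
  tk p = tk e.2 -> ~ cl e.1.1 p]) (M * M * N).
Proof.
have -> : M * M * N = #|{: 'I_M * 'I_M * 'I_N}| by rewrite !card_prod !card_ord.
apply: (@at_most_token _ _ (fun e t => t = (Ordinal (ti_lt e.2), Ordinal (tj_lt e.1.1),
  Ordinal (tk_lt e.2)))); first by move=> e _; eexists.
move=> [[m l] r] [[m' l'] r'] t /= [al ei hj ex] [al' ei' hj' ex'] -> [eti etj etk].
have [cml cmr s lt co] := al; have [cml' cmr' s' lt' co'] := al'.
have mm := class_line_inj xI prI tj_mono cml cmr s hj cml' cmr' s' hj' etj; subst m'.
have rr : r = r'.
  apply: point_eq => //; case: (ltngtP (tj r) (tj r')) => // h.
  - have [p [pi pj pk]] : exists p, [/\ ti p = ti r, tj p = (tj r).+1 & tk p = tk r].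
      by apply: point_ex => //; have := tj_lt r'; lia.
    case: (ex p pi pj pk); apply: (cell_convex cmr cmr').
    have up : u p = u r' by rewrite /u pi pk eti etk.
    by have := xlex r p; have := xlex r' p; lia.
  - have [p [pi pj pk]] : exists p, [/\ ti p = ti r', tj p = (tj r').+1 & tk p = tk r'].
      by apply: point_ex => //; have := tj_lt r; lia.
    case: (ex' p pi pj pk); apply: (cell_convex cmr' cmr).
    have up : u p = u r by rewrite /u pi pk eti etk.
    by have := xlex r' p; have := xlex r p; lia.
by subst r'; rewrite (alternation_left yI al al').
Qed.

Let same_row_enter : at_most (fun e => [/\ alt false e, ti e.1.2 = ti e.2,
  tj e.1.2 < tj e.1.1 < tj e.2 & forall p, ti p = ti e.1.2 -> (tj p).+1 = tj e.1.2 ->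
  tk p = tk e.1.2 -> ~ cl e.1.1 p]) (M * M * N).
Proof.
have -> : M * M * N = #|{: 'I_M * 'I_M * 'I_N}| by rewrite !card_prod !card_ord.
apply: (@at_most_token _ _ (fun e t => t = (Ordinal (ti_lt e.1.2), Ordinal (tj_lt e.1.1),
  Ordinal (tk_lt e.1.2)))); first by move=> e _; eexists.
move=> [[m l] r] [[m' l'] r'] t /= [al ei hj ex] [al' ei' hj' ex'] -> [eti etj etk].
have [cml cmr s lt co] := al; have [cml' cmr' s' lt' co'] := al'.
have mm := class_line_inj xI prI tj_mono cml cmr s hj cml' cmr' s' hj' etj; subst m'.
have ll : l = l'.
  apply: point_eq => //; case: (ltngtP (tj l) (tj l')) => // h.
  - have [p [pi pj pk]] : exists p, [/\ ti p = ti l', tj p = (tj l').-1 & tk p = tk l'].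
      by apply: point_ex => //; have := tj_lt l'; lia.
    case: (ex' p pi _ pk); first lia; apply: (cell_convex cml cml').
    have up : u p = u l by rewrite /u pi pk eti etk.
    by have := xlex p l; have := xlex p l'; lia.
  - have [p [pi pj pk]] : exists p, [/\ ti p = ti l, tj p = (tj l).-1 & tk p = tk l].
      by apply: point_ex => //; have := tj_lt l; lia.
    case: (ex p pi _ pk); first lia; apply: (cell_convex cml' cml).
    have up : u p = u l' by rewrite /u pi pk eti etk.
    by have := xlex p l'; have := xlex p l; lia.
by subst l'; rewrite (alternation_right yI al al').
Qed.

(** [r] is the highest point of its row in the slab, so line and row determine it. *)
Let same_row_branch : at_most (fun e => [/\ alt false e, ti e.1.2 = ti e.2,
  v e.1.2 = (v e.2).+1 & branch x pr (fun p => (ti p, v p)) e.1.1 (ti e.2, v e.2)]) #|T|.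
Proof.
apply: (@at_most_branch _ x pr xI prI _ (fun p => (ti p, v p)) (fun e => (ti e.2, v e.2))).
  by move=> e [].
move=> [[m l] r] [[m' l'] r'] /= [al ei hv _] [al' ei' hv' _] mm [eti ev]; subst m'.
have [cml cmr s lt co] := al; have [cml' cmr' s' lt' co'] := al'.
have rr : r = r'.
  apply: yI; case: (ltngtP (y r) (y r')) => // h.
  - by have := co _ cmr'; have := ylex r' l; lia.
  - by have := co' _ cmr; have := ylex r l'; lia.
by subst r'; rewrite (alternation_left yI al al').
Qed.

(** Suppose the next copy [p] of [r] and the previous copy [q] of [l] are in the slab. Neither comes
    between [r] and [l] in height, so [l] is exactly one row above [r]; then [q] and [r] share a row
    split by [m]. *)
Let same_row_false : at_most (fun e => [/\ alt false e, ti e.1.2 = ti e.2 &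
  tj e.1.2 < tj e.1.1 < tj e.2]) (M * M * N + M * M * N + #|T|).
Proof.
apply: (at_most_sub _ (at_most_or (at_most_or same_row_exit same_row_enter) same_row_branch)).
move=> [[m l] r] /= [al ei hj].
case: (pselect (forall p, ti p = ti r -> tj p = (tj r).+1 -> tk p = tk r -> ~ cl m p)) => [h|h].
  by left; left; split.
case: (pselect (forall p, ti p = ti l -> (tj p).+1 = tj l -> tk p = tk l -> ~ cl m p)) => [h'|h'].
  by left; right; split.
right; have [p [pi pj pk cp]] : exists p, [/\ ti p = ti r, tj p = (tj r).+1, tk p = tk r & cl m p].
  by apply: contrapT => np; apply: h => p ? ? ? ?; apply: np; exists p.
have [q [qi qj qk cq]] : exists p, [/\ ti p = ti l, (tj p).+1 = tj l, tk p = tk l & cl m p].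
  by apply: contrapT => np; apply: h' => p' ? ? ? ?; apply: np; exists p'.
have [cml cmr s lt co] := al.
have eB : B p = B r by apply/eqP; rewrite B_eq pk.
have eB' : B q = B l by apply/eqP; rewrite B_eq qk.
have vv : v l = (v r).+1.
  have [_ cop] := co _ cp; have [_ coq] := co _ cq.
  move: (ylex r l) (ylex r p) (ylex p l) (ylex r q) (ylex q l) lt cop coq ei hj.
  by rewrite /v eB eB' pi pj -qj qi; clear; lia.
split=> //; exists q, r; split=> //=.
  by congr (_, _); [congruence | rewrite /v in vv *; lia].
by have := xlex q l; lia.
Qed.

(** * Alternations between block rows *)

Let next_column_up : at_most (fun e => alt true e /\ ti e.1.2 < ti e.2 /\
  ((tj e.1.2 = tj e.2 /\ u e.1.2 = u e.2) \/
   [/\ ti e.2 = (ti e.1.2).+1, tj e.2 = tj e.1.2 & tk e.2 = tk e.1.2])) (#|T| + #|T|).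
Proof.
pose D1 (e : T * T * T) := alt true e /\ ti e.1.2 < ti e.2 /\ (tj e.1.2 = tj e.2 /\ u e.1.2 = u e.2).
pose D2 (e : T * T * T) := alt true e /\
  [/\ ti e.2 = (ti e.1.2).+1, tj e.2 = tj e.1.2 & tk e.2 = tk e.1.2].
have h1 : at_most D1 #|T|.
  apply: (@at_most_token _ _ (fun e t => t = e.1.2)); first by move=> e _; exists e.1.2.
  move=> [[m l] r] [[m' l'] r'] t [al [ei [ej eu]]] [al' [ei' [ej' eu']]] -> ll.
  rewrite /= in ei ej eu ei' ej' eu' ll; subst l'.
  have [cml cmr s lt co] := al; have [cml' cmr' s' lt' co'] := al'.
  (* A column rises from left to right, so the lower of [r] and [r'] would come between [l] and the
     other. *)
  have rr : r = r'.
    case: (ltngtP (ti r) (ti r')) => h.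
    - have cr : cl m' r by apply: (cell_convex cml' cmr'); have := xlex l r; have := xlex r r'; lia.
      by have := co' _ cr; have := ylex r r'; lia.
    - have cr : cl m r' by apply: (cell_convex cml cmr); have := xlex l r'; have := xlex r' r; lia.
      by have := co _ cr; have := ylex r' r; lia.
    - by apply: xI; have := xlex r r'; have := xlex r' r; lia.
  by subst r'; rewrite (alternation_line xI prI al al').
have h2 : at_most D2 #|T|.
  apply: (@at_most_token _ _ (fun e t => t = e.1.2)); first by move=> e _; exists e.1.2.
  move=> [[m l] r] [[m' l'] r'] t [al [ei ej ek]] [al' [ei' ej' ek']] -> ll.
  rewrite /= in ei ej ek ei' ej' ek' ll; subst l'.
  have rr : r = r' by apply: point_eq; congruence.
  by subst r'; rewrite (alternation_line xI prI al al').
apply: (at_most_sub _ (at_most_or h1 h2)) => e [al [ei [h|h]]]; [left|right] => //.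
Qed.

(** In its block row, [l] is the extreme point of the slab in the direction of [r], so line and
    block row determine it. *)
Let branch_left b : at_most (fun e => [/\ alt b e, ti e.1.2 != ti e.2 &
  branch x pr ti e.1.1 (ti e.1.2)]) #|T|.
Proof.
apply: (@at_most_branch _ x pr xI prI _ ti (fun e => ti e.1.2)); first by move=> e [].
move=> [[m l] r] [[m' l'] r'] /= [al ei _] [al' ei' _] mm eti; subst m'.
have [cml cmr s lt co] := al; have [cml' cmr' s' lt' co'] := al'.
have ll : l = l'.
  apply: yI; case: (ltngtP (y l) (y l')) => // h.
  - case: b lt lt' {al al'} => lt lt'.
      by have := co _ cml'; have := ylex l r; have := ylex l' r; lia.
    by have := co' _ cml; have := ylex r' l'; have := ylex r' l; lia.
  - case: b lt lt' {al al'} => lt lt'.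
      by have := co' _ cml; have := ylex l' r'; have := ylex l r'; lia.
    by have := co _ cml'; have := ylex r l; have := ylex r l'; lia.
by subst l'; rewrite (alternation_right yI al al').
Qed.

Let branch_right b : at_most (fun e => [/\ alt b e, ti e.1.2 != ti e.2 &
  branch x pr ti e.1.1 (ti e.2)]) #|T|.
Proof.
apply: (@at_most_branch _ x pr xI prI _ ti (fun e => ti e.2)); first by move=> e [].
move=> [[m l] r] [[m' l'] r'] /= [al ei _] [al' ei' _] mm eti; subst m'.
have [cml cmr s lt co] := al; have [cml' cmr' s' lt' co'] := al'.
have rr : r = r'.
  apply: yI; case: (ltngtP (y r) (y r')) => // h.
  - case: b lt lt' {al al'} => lt lt'.
      by have := co' _ cmr; have := ylex l' r'; have := ylex l' r; lia.
    by have := co _ cmr'; have := ylex r l; have := ylex r' l; lia.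
  - case: b lt lt' {al al'} => lt lt'.
      by have := co _ cmr'; have := ylex l r; have := ylex l r'; lia.
    by have := co' _ cmr; have := ylex r' l'; have := ylex r l'; lia.
by subst r'; rewrite (alternation_left yI al al').
Qed.

(* Otherwise the successor [p] of [l] or the predecessor [q] of [r] is in the
   slab and, together with [r] or [l], splits a block row. *)
Let rows_up : at_most (fun e => alt true e /\ ti e.1.2 != ti e.2)
  (#|T| + #|T| + (#|T| + #|T|)).
Proof.
apply: (at_most_sub _ (at_most_or next_column_up
  (at_most_or (@branch_left true) (@branch_right true)))).
move=> [[m l] r] /= [al ne]; have [cml cmr s lt co] := al.
have ei : ti l < ti r by have := ylex l r; lia.
case: (boolP ((tj l == tj r) && (u l == u r))) => [/andP[/eqP ? /eqP ?]|nc].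
  by left; split=> //; split=> //; left.
have [p [pi pj pk]] : exists p, [/\ ti p = (ti l).+1, tj p = tj l & tk p = tk l].
  by apply: point_ex => //; have := ti_lt r; lia.
have up : u p = (u l).+1 by rewrite /u pi pk addnS.
case: (eqVneq p r) => [pr_|npr].
  by left; split=> //; split=> //; right; subst r.
have lp : x l < x p by have := xlex l p; lia.
have pr_ : x p < x r.
  have : x p <> x r by move/xI => e; rewrite e eqxx in npr.
  by have := xlex l r; have := xlex r p; lia.
have cp : cl m p by apply: (cell_convex cml cmr); lia.
have nyp : y p <> y r by move/yI => e; rewrite e eqxx in npr.
have yp : y r < y p by have := co _ cp; have := ylex l p; lia.
have ir : ti r = ti p by have := ylex r p; lia.
have [q [qi qj qk]] : exists q, [/\ ti q = ti l, tj q = tj r & tk q = tk r].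
  by apply: point_ex.
have uq : u r = (u q).+1 by rewrite /u qi qk ir pi addnS.
have lq : x l < x q by have := xlex l q; have := xlex p r; lia.
have qr : x q < x r by have := xlex q r; lia.
have cq : cl m q by apply: (cell_convex cml cmr); lia.
case: (leqP (x p) (x m)) => hp; first by right; right; split=> //; exists p, r; split=> //; lia.
case: (ltnP (x m) (x q)) => hq; first by right; left; split=> //; exists l, q; split=> //; lia.
(* Now [x q <= x m < x p], so [q] is in the column of [l] or the next one. They lie in the same
   block, where the even offsets keep distinct exponents at least two columns apart. *)
have [e|lk] : tk l = tk q \/ tk l <> tk q by lia.
  have nu : u l = u q by rewrite /u qi e.
  have : l <> q by move=> e'; rewrite e' ltnn in lq.
  by have := @point_eq l q; have := xlex l q; have := xlex q p; lia.
have pl : 2 ^ (tk l).+1 = 2 * 2 ^ tk l by rewrite expnS.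
have pq : 2 ^ (tk q).+1 = 2 * 2 ^ tk q by rewrite expnS.
have lq2 : tj l = tj q /\ u l <= u q <= (u l).+1 by have := xlex l q; have := xlex q p; lia.
have ne2 : 2 ^ (tk l) <> 2 ^ (tk q) by move=> /eqP; rewrite eqn_exp2l // => /eqP.
by rewrite /u qi pl pq in lq2; lia.
Qed.

(** The column of [m] gives the line, and [r] is the last point of its exponent in the slab: before
    another one, its copy one column to the right would be in the slab too. *)
Let rows_down_exit : at_most (fun e => [/\ alt false e, ti e.2 < ti e.1.2,
  col e.1.2 < col e.1.1 < col e.2 & forall p, ti p = (ti e.2).+1 -> tj p = tj e.2 ->
  tk p = tk e.2 -> ~ cl e.1.1 p]) (M * (M * 2) * N).
Proof.
have -> : M * (M * 2) * N = #|{: 'I_M * 'I_(M * 2) * 'I_N}| by rewrite !card_prod !card_ord.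
apply: (@at_most_token _ _ (fun e t => t = (Ordinal (tj_lt e.1.1), Ordinal (u_lt e.1.1),
  Ordinal (tk_lt e.2)))); first by move=> e _; eexists.
move=> [[m l] r] [[m' l'] r'] t /= [al ei hj ex] [al' ei' hj' ex'] -> [etj etu etk].
have [cml cmr s lt co] := al; have [cml' cmr' s' lt' co'] := al'.
have em : col m = col m' by rewrite /col etj etu.
have mm := class_line_inj xI prI col_mono cml cmr s hj cml' cmr' s' hj' em; subst m'.
have key r1 r2 l1 : cl m r1 -> cl m r2 -> tk r1 = tk r2 -> ti r1 < ti l1 ->
    (forall p, ti p = (ti r1).+1 -> tj p = tj r1 -> tk p = tk r1 -> ~ cl m p) ->
    x r1 < x r2 -> False.
  move=> c1 c2 ek li ex1 lt12.
  have [p [pi pj pk]] : exists p, [/\ ti p = (ti r1).+1, tj p = tj r1 & tk p = tk r1].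
    by apply: point_ex => //; have := ti_lt l1; lia.
  apply: (ex1 p) => //; apply: (cell_convex c1 c2).
  have u1 : u r1 = 2 ^ (tk r2).+1 + ti r1 by rewrite /u ek.
  have up : u p = 2 ^ (tk r2).+1 + ti p by rewrite /u pk ek.
  have u2 : u r2 = 2 ^ (tk r2).+1 + ti r2 by [].
  by have := xlex r1 p; have := xlex r2 p; have := xlex r1 r2; lia.
have rr : r = r'.
  apply: xI; case: (ltngtP (x r) (x r')) => // h.
    by case: (key r r' l).
  by case: (key r' r l').
by subst r'; rewrite (alternation_left yI al al').
Qed.

(** If the copy [p] of [r] in the next block row is in the slab, it does not come between [r] and
    [l], so it lies in the block row of [l], which [m] splits. Otherwise [m] is in the column of an
    end, or [rows_down_exit] applies. *)
Let rows_down : at_most (fun e => alt false e /\ ti e.1.2 != ti e.2)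
  (#|T| + #|T| + (#|T| + #|T|) + M * (M * 2) * N).
Proof.
apply: (at_most_sub _ (at_most_or (at_most_or
  (at_most_or (@branch_left false) (@branch_right false))
  (at_most_or (at_most_left_class xI yI prI col_mono (b := false))
              (at_most_right_class xI yI prI col_mono (b := false)))) rows_down_exit)).
move=> [[m l] r] /= [al ne]; have [cml cmr s lt co] := al.
have ei : ti r < ti l by have := ylex r l; lia.
case: (pselect (branch x pr ti m (ti l))) => [h|bl]; first by left; left; left.
have ex p : ti p = (ti r).+1 -> tj p = tj r -> tk p = tk r -> ~ cl m p.
  move=> pi pj pk cp.
  have up : u p = (u r).+1 by rewrite /u pi pk addnS.
  have rp : x r < x p by have := xlex r p; lia.
  have il : ti p = ti l by have := co _ cp; have := ylex r p; have := ylex p l; lia.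
  by apply: bl; exists l, p; split=> //; lia.
have clr : col l < col r.
  rewrite ltn_neqAle col_mono ?andbT; last lia.
  apply/eqP => e; have := col_lt l r; have := col_lt r l; rewrite e ltnn.
  by have := xlex l r; lia.
have clm : col l <= col m by apply: col_mono; lia.
have cmr_ : col m <= col r by apply: col_mono; lia.
case: (eqVneq (col m) (col l)) => h1; first by left; right; left.
case: (eqVneq (col m) (col r)) => h2; first by left; right; right.
by right; split=> //; lia.
Qed.

Hypothesis card_T : #|T| = M * M * N.

(** The constant is 10 for single blocks, 3 for block rows, 2 for lines in the block column of an
    end, and 6 for pairs of block rows. *)
Lemma at_most_alternation b : at_most (alt b) (21 * #|T|).
Proof.
have c2 : M * (M * 2) * N = 2 * #|T| by rewrite card_T; lia.
have class_l := at_most_left_class xI yI prI tj_mono (b := b).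
have class_r := at_most_right_class xI yI prI tj_mono (b := b).
have rows : at_most (fun e => alt b e /\ ti e.1.2 != ti e.2) (6 * #|T|).
  case: b {class_l class_r}; [apply: at_most_le rows_up _ | apply: at_most_le rows_down _].
    by lia.
  by rewrite c2; lia.
have row : at_most (fun e => [/\ alt b e, ti e.1.2 = ti e.2 &
    tj e.1.2 < tj e.1.1 < tj e.2]) (3 * #|T|).
  case: b {class_l class_r rows}.
    by apply: at_most_le (at_most_sub _ same_row_up) _ => [e []|] //; lia.
  by apply: at_most_le same_row_false _; rewrite -card_T; lia.
apply: at_most_le (at_most_sub _ (at_most_or (at_most_or (@same_block b) row)
  (at_most_or (at_most_or class_l class_r) rows))) _; last by rewrite c2; lia.
move=> [[m l] r] al; have [_ _ s _ _] := al.
case: (eqVneq (ti l) (ti r)) => ei; last by right; right.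
case: (eqVneq (tj l) (tj r)) => ej; first by left; left.
have lm : tj l <= tj m by apply: tj_mono; lia.
have mr : tj m <= tj r by apply: tj_mono; lia.
case: (eqVneq (tj m) (tj l)) => h1; first by right; left; left; split=> //=; lia.
case: (eqVneq (tj m) (tj r)) => h2; first by right; left; right; split=> //=; lia.
by left; right; split=> //=; lia.
Qed.

End GridBound.

(** * Satisfied supersets of bit-reversal blocks *)

Section SatisfiedSets.
Import Order.TTheory GRing.Theory Num.Theory.
Local Open Scope ring_scope.

Lemma eq_satisfied S S' : S =i S' -> satisfied S = satisfied S'.
Proof.
move=> e; rewrite /satisfied (eq_all_r e); apply: eq_all => p.
rewrite (eq_all_r e); apply: eq_all => q; congr (_ || _).
by rewrite /pair_satisfied (eq_has_r e).
Qed.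

Lemma satisfiedP S : reflect (forall p q : point, p \in S -> q \in S -> p.1 != q.1 -> p.2 != q.2 ->
  exists r : point, [/\ r \in S, r != p, r != q & in_box p q r]) (satisfied S).
Proof.
apply: (iffP allP) => [h p q pS qS n1 n2|h p pS].
  have /allP/(_ q qS) := h p pS.
  rewrite /collinear (negPf n1) (negPf n2) /= => /hasP[r rS /and3P[? ? ?]].
  by exists r.
apply/allP => q qS; rewrite /collinear; case: eqP => //= /eqP n1; case: eqP => //= /eqP n2.
by have [r [rS a b c]] := h p q pS qS n1 n2; apply/hasP; exists r => //; rewrite a b.
Qed.

Lemma satisfied_filter (a : pred point) S :
  (forall p q r, a p -> a q -> in_box p q r -> a r) -> satisfied S -> satisfied (filter a S).
Proof.
move=> conv /satisfiedP h; apply/satisfiedP => p q.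
rewrite !mem_filter => /andP[ap pS] /andP[aq qS] n1 n2.
have [r [rS ? ? box]] := h p q pS qS n1 n2.
by exists r; split=> //; rewrite mem_filter rS (conv p q).
Qed.

(** The point satisfying the pair replaces the end on its side of [c]; the distance decreases until
    both ends share a row. *)
Lemma row_crossing S (c lo hi : int) (p q : point) : satisfied S ->
  p \in S -> q \in S -> p.1 < c <= q.1 -> lo <= p.2 <= hi -> lo <= q.2 <= hi ->
  exists p' q' : point, [/\ p' \in S, q' \in S, p'.1 < c <= q'.1, p'.2 = q'.2 & lo <= p'.2 <= hi].
Proof.
move=> /satisfiedP sat.
have [n] := ubnP (`|(q.1 - p.1)%R| + `|(q.2 - p.2)%R|)%N.
elim: n p q => [|n IH] p q; first by lia.
move=> lt pS qS hc hp hq; case: (eqVneq p.2 q.2) => n2; first by exists p, q.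
have n1 : p.1 != q.1 by lia.
have [r [rS rp rq]] := sat p q pS qS n1 n2; rewrite /in_box => box.
have rp' : (r.1 != p.1) || (r.2 != p.2).
  by rewrite -negb_and; apply: contra rp => /andP[/eqP e1 /eqP e2]; rewrite (surjective_pairing r) e1 e2 -surjective_pairing.
have rq' : (r.1 != q.1) || (r.2 != q.2).
  by rewrite -negb_and; apply: contra rq => /andP[/eqP e1 /eqP e2]; rewrite (surjective_pairing r) e1 e2 -surjective_pairing.
by case: (ltP r.1 c) => hr; [apply: (IH r q) | apply: (IH p r)] => //; lia.
Qed.

End SatisfiedSets.

(** The top bit of [k] becomes the lowest bit of the value: [k] and [k + 2 ^ q'] get adjacent
    values, and each half is again a bit reversal. *)
Fixpoint bitrev (q k : nat) : nat :=
  if q is q'.+1 then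
    if (k < 2 ^ q')%N then (2 * bitrev q' k)%N else (2 * bitrev q' (k - 2 ^ q') + 1)%N
  else 0%N.

Lemma bitrev_inj q k k' :
  (k < 2 ^ q)%N -> (k' < 2 ^ q)%N -> bitrev q k = bitrev q k' -> k = k'.
Proof.
elim: q k k' => [|q IH] k k' /=; first by lia.
rewrite expnS => hk hk'; case: ltnP => a; case: ltnP => b; try lia.
  by move=> e; apply: IH => //; lia.
by move=> e; have := IH (k - 2 ^ q)%N (k' - 2 ^ q)%N; lia.
Qed.

Definition rows (S : seq point) : seq int := undup (map snd S).

Lemma mem_rows S (p : point) : p \in S -> p.2 \in rows S.
Proof. by move=> pS; rewrite mem_undup; apply: map_f. Qed.

Lemma rowsP S (r : int) : reflect (exists2 p : point, p \in S & p.2 = r) (r \in rows S).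
Proof.
rewrite mem_undup; apply: (iffP mapP) => [[p pS ->]|[p pS <-]]; by exists p.
Qed.

(* [size S - size (rows S)] counts horizontally adjacent pairs of [S]. When [S]
   is cut vertically, it drops by the number of rows meeting both sides, and each
   of the [2 ^ q] alternations of the bit-reversal permutation yields such a row. *)
Lemma bitrev_lower_bound q S (f : nat -> point) : satisfied S -> uniq S ->
  (forall k, k < 2 ^ q -> f k \in S)%N ->
  (forall k k', (k < k')%N -> (k' < 2 ^ q)%N -> ((f k).1 < (f k').1)%R) ->
  (forall k k', (k < 2 ^ q)%N -> (k' < 2 ^ q)%N -> (bitrev q k < bitrev q k')%N ->
     ((f k).2 < (f k').2)%R) ->
  (2 * size (rows S) + q * 2 ^ q <= 2 * size S)%N.
Proof.
elim: q S f => [|q IH] S f sat uS fS f1 f2.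
  by rewrite mul0n addn0 leq_mul2l /= (leq_trans (size_undup _)) ?size_map.
pose c := (f (2 ^ q)%N).1.
pose left_ (p : point) := (p.1 < c)%R.
pose L := filter left_ S; pose R := filter (predC left_) S.
have e2 : (2 ^ q.+1 = 2 ^ q + 2 ^ q)%N by rewrite expnS; lia.
have p0 : (0 < 2 ^ q)%N by rewrite expn_gt0.
have fL k : (k < 2 ^ q)%N -> f k \in L.
  by move=> hk; rewrite mem_filter fS ?andbT; [apply: f1|]; lia.
have fR k : (k < 2 ^ q)%N -> f (k + 2 ^ q)%N \in R.
  move=> hk; rewrite mem_filter fS ?andbT; last by lia.
  rewrite /= /left_ /c -Order.TotalTheory.leNgt.
  case: (posnP k) => [->|k0]; first by rewrite add0n.
  by apply: Order.POrderTheory.ltW; apply: f1; lia.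
have hL : (2 * size (rows L) + q * 2 ^ q <= 2 * size L)%N.
  apply: (IH L f).
  - by apply: satisfied_filter => // p p' r; rewrite /left_ /in_box; lia.
  - exact: filter_uniq.
  - exact: fL.
  - by move=> k k' h h'; apply: f1; lia.
  - by move=> k k' h h' lt; apply: f2; rewrite /= ?h ?h'; lia.
have hR : (2 * size (rows R) + q * 2 ^ q <= 2 * size R)%N.
  apply: (IH R (fun k => f (k + 2 ^ q)%N)).
  - by apply: satisfied_filter => // p p' r; rewrite /= /left_ /in_box; lia.
  - exact: filter_uniq.
  - exact: fR.
  - by move=> k k' h h'; apply: f1; lia.
  - move=> k k' h h' lt; apply: f2; try lia.
    by rewrite /= !ltnNge !leq_addl /= !addnK; lia.
have szS : size S = (size L + size R)%N by rewrite !size_filter count_predC.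
pose both := [seq r <- rows R | r \in rows L].
have szR : size (rows R) = (size both + size [seq r <- rows R | r \notin rows L])%N.
  by rewrite !size_filter count_predC.
have szrows : (size (rows S) <= size (rows L) + size [seq r <- rows R | r \notin rows L])%N.
  rewrite -size_cat; apply: uniq_leq_size; first exact: undup_uniq.
  move=> r /rowsP[p pS <-]; rewrite mem_cat mem_filter.
  case: (boolP (p.2 \in rows L)) => //= h; apply: mem_rows.
  rewrite mem_filter pS andbT /=; apply: contra h => lp; apply: mem_rows.
  by rewrite mem_filter lp.
(* [f k] and [f (k + 2 ^ q)] are on opposite sides of [c], so some row between their heights meets
   both sides. *)
have win k : (k < 2 ^ q)%N -> exists2 r : int, r \in both &
    ((f k).2 <= r <= (f (k + 2 ^ q)%N).2)%R.
  move=> hk.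
  have lt2 : ((f k).2 < (f (k + 2 ^ q)%N).2)%R.
    by apply: f2; rewrite /= ?hk ?ltnNge ?leq_addl /= ?addnK; lia.
  have := fL k hk; have := fR k hk; rewrite !mem_filter => /andP[hr rS] /andP[hl lS].
  have [p' [q' [p'S q'S hc' e hb]]] : exists p' q' : point, [/\ p' \in S, q' \in S,
      (p'.1 < c <= q'.1)%R, p'.2 = q'.2 & ((f k).2 <= p'.2 <= (f (k + 2 ^ q)%N).2)%R].
    apply: row_crossing sat lS rS _ _ _; last by lia.
      by move: hl hr; rewrite /= /left_; lia.
    by lia.
  exists p'.2 => //; rewrite mem_filter mem_rows /= ?mem_filter /= /left_; last first.
    by rewrite p'S; lia.
  by rewrite e mem_rows // mem_filter q'S /left_ /= andbT; lia.
(* The height windows of distinct [k] are disjoint, so their rows are distinct. *)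
have big : (2 ^ q <= size both)%N.
  pose g k := nth 0%R both (find (fun r => ((f k).2 <= r <= (f (k + 2 ^ q)%N).2)%R) both).
  have hg k : (k < 2 ^ q)%N -> g k \in both /\ ((f k).2 <= g k <= (f (k + 2 ^ q)%N).2)%R.
    move=> /win[r rb hr]; have h : has (fun r => ((f k).2 <= r <= (f (k + 2 ^ q)%N).2)%R) both.
      by apply/hasP; exists r.
    by split; [apply: mem_nth; rewrite -has_find | apply: (nth_find 0%R h)].
  have g_lt k k' : (k < 2 ^ q)%N -> (k' < 2 ^ q)%N -> (bitrev q k < bitrev q k')%N ->
      (g k < g k')%R.
    move=> hk hk' lt; have [_ a] := hg k hk; have [_ b] := hg k' hk'.
    have : ((f (k + 2 ^ q)%N).2 < (f k').2)%R; last by lia.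
    by apply: f2; rewrite /= ?hk' ?ltnNge ?leq_addl /= ?addnK; lia.
  rewrite -[X in (X <= _)%N](size_iota 0 (2 ^ q)) -(size_map g); apply: uniq_leq_size.
    rewrite map_inj_in_uniq ?iota_uniq // => k k'; rewrite !mem_iota /= => hk hk' e.
    apply: (bitrev_inj (q := q)); try lia.
    have := g_lt k k'; have := g_lt k' k; rewrite e; lia.
  by move=> r /mapP[k]; rewrite mem_iota /= => hk ->; case: (hg k) => //; lia.
rewrite szS mulSn e2 mulnDr; lia.
Qed.

(** Satisfaction passes to each convex box, and the boxes are disjoint, so the bounds add up. *)
Lemma blocks_lower_bound (I : finType) (box : I -> pred point) (f : I -> nat -> point)
    q (X Y : seq point) :
  (forall i p p' r, box i p -> box i p' -> in_box p p' r -> box i r) ->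
  (forall i i' p, box i p -> box i' p -> i = i') ->
  (forall i k, (k < 2 ^ q)%N -> f i k \in X /\ box i (f i k)) ->
  (forall i k k', (k < k')%N -> (k' < 2 ^ q)%N -> ((f i k).1 < (f i k').1)%R) ->
  (forall i k k', (k < 2 ^ q)%N -> (k' < 2 ^ q)%N -> (bitrev q k < bitrev q k')%N ->
     ((f i k).2 < (f i k').2)%R) ->
  satisfied (X ++ Y) ->
  (#|I| * (q * 2 ^ q) <= 2 * (size X + size (undup Y)))%N.
Proof.
move=> conv disj fX f1 f2 sat; pose S := undup (X ++ Y).
have satS : satisfied S by rewrite (eq_satisfied (mem_undup _)).
have szS : (size S <= size X + size (undup Y))%N.
  rewrite -size_cat; apply: uniq_leq_size; first exact: undup_uniq.
  by move=> p; rewrite !mem_undup !mem_cat mem_undup.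
apply: leq_trans (_ : _ <= 2 * size S)%N _; last by rewrite leq_mul2l.
have blk i : (q * 2 ^ q <= 2 * count (box i) S)%N.
  have := @bitrev_lower_bound q (filter (box i) S) (f i).
  rewrite size_filter => h; apply: leq_trans (h _ _ _ _ _); first exact: leq_addl.
  - by apply: satisfied_filter => // p p' r; apply: conv.
  - by rewrite filter_uniq ?undup_uniq.
  - by move=> k /(fX i)[fk bk]; rewrite mem_filter bk mem_undup mem_cat fk.
  - exact: f1.
  - exact: f2.
apply: leq_trans (_ : \sum_(i : I) 2 * count (box i) S <= _)%N.
  by rewrite -sum_nat_const; apply: leq_sum => i _; apply: blk.
rewrite -big_distrr leq_mul2l /=.
under eq_bigr do rewrite -sum1_count big_mkcond.
rewrite exchange_big /= -(sum1_size S) leq_sum // => p _.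
rewrite -big_mkcond /= sum1_card; apply/card_le1_eqP => i i' h h'.
by apply/esym; apply: (disj i i' p); [exact: h | exact: h'].
Qed.

(** The grid spanned by the coordinates of [X] makes it satisfied, with the corner [(p.1, q.2)] as
    witness; so a minimum exists. *)
Lemma opt_ex (X : seq point) : exists m, is_opt X m.
Proof.
pose P m := `[< exists Y, size (undup Y) = m /\ satisfied (X ++ Y) >].
pose Y := [seq (a, b) | a <- map fst X, b <- map snd X].
have YE p : (p \in Y) = (p.1 \in map fst X) && (p.2 \in map snd X).
  apply/allpairsP/andP => [[[a b] /= [ha hb ->]] //|[ha hb]].
  by exists p; rewrite -surjective_pairing.
have XY p : p \in X ++ Y -> p \in Y.
  by rewrite mem_cat => /orP[pX|//]; rewrite YE !map_f.
have exP : exists m, P m.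
  exists (size (undup Y)); apply/asboolP; exists Y; split=> //; apply/satisfiedP => p q.
  move=> /XY; rewrite YE => /andP[p1 p2] /XY; rewrite YE => /andP[q1 q2] n1 n2.
  exists (p.1, q.2); split.
  - by rewrite mem_cat YE /= p1 q2 orbT.
  - by rewrite -pair_eqE /= eqxx eq_sym.
  - by rewrite -pair_eqE /= (negPf n1).
  - by rewrite /in_box /=; lia.
exists (ex_minn exP); case: ex_minnP => m /asboolP hm min; split=> // Z sZ.
by apply: min; apply/asboolP; exists Z.
Qed.

(** * Guillotine costs and alternations *)

Section GuillotineCost.
Local Open Scope nat_scope.

Lemma at_most_image (E E' : eqType) (g : E' -> E) (D : E -> Prop) (D' : E' -> Prop) c :
  (forall e, D e -> exists2 e', D' e' & g e' = e) -> at_most D' c -> at_most D c.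
Proof.
move=> ex h s us hs.
have [s' hs' es] : exists2 s' : seq E', (forall e', e' \in s' -> D' e') & map g s' = s.
  elim: s hs {us} => [|e s IH] hs; first by exists [::].
  have [|s' h1 h2] := IH; first by move=> e' e's; apply: hs; rewrite inE e's orbT.
  have [e' De' ge'] := ex e (hs e (mem_head _ _)).
  by exists (e' :: s'); [move=> a; rewrite inE => /predU1P[->|/h1] | rewrite /= ge' h2].
by rewrite -es size_map; apply: h => //; apply: (map_uniq (f := g)); rewrite es.
Qed.

Lemma opp_pairs_map (T : Type) (f : T -> point) (side : point -> bool) (s : seq T) :
  opp_pairs side (map f s) =
  count (fun ab => side (f ab.1) != side (f ab.2)) (zip s (behead s)).
Proof.
rewrite /opp_pairs; case: s => // a s /=; elim: s a => //= b s IH a.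
by rewrite IH.
Qed.

Lemma count_zip_behead (T : Type) (c : T -> T -> bool) (a : pred T) (s : seq T) :
  (forall s1 p q s2, s = s1 ++ p :: q :: s2 -> c p q -> a p) ->
  count (fun ab => c ab.1 ab.2) (zip s (behead s)) <= count a s.
Proof.
case: s => // p s; elim: s p => //= [q s IH] p h; apply: leq_add; last first.
  by apply: IH => s1 p' q' s2 e; apply: (h (p :: s1) p' q' s2); rewrite /= e.
by case: (boolP (c p q)) => // cpq; rewrite (h [::] p q s).
Qed.

Variables (T : finType) (rx ry : T -> nat).
Let n := #|T|.
Hypotheses (rxI : injective rx) (ryI : injective ry).
Hypotheses (rx_range : forall p, 0 < rx p <= n) (ry_range : forall p, 0 < ry p <= n).

Let pt p : point := ((rx p)%:Z, (ry p)%:Z)%R.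
Let X := map pt (enum T).

(* [d = true] is the horizontal coordinate, as in the encoding of lines. *)
Let co (d : bool) := if d then rx else ry.
Let pco (d : bool) (p : point) := if d then p.1 else p.2.
Let ax (d : bool) (P : rect) := if d then P.1 else P.2.

Let coI d : injective (co d). Proof. by case: d. Qed.
Let co_range d p : 0 < co d p <= n. Proof. by case: d. Qed.
Let pco_pt d p : pco d (pt p) = (co d p)%:Z%R. Proof. by case: d. Qed.

Let co_surj d k : 0 < k <= n -> exists p, co d p = k.
Proof.
move=> hk; have us : uniq (map (co d) (enum T)).
  by rewrite map_inj_uniq ?enum_uniq //; apply: coI.
have sub : {subset map (co d) (enum T) <= iota 1 n}.
  by move=> a /mapP[p _ ->]; rewrite mem_iota; have := co_range d p; lia.
have h : k \in map (co d) (enum T).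
  have sz : size (iota 1 n) <= size (map (co d) (enum T)) by rewrite size_iota size_map -cardE.
  by have [_ ->] := uniq_min_size us sub sz; rewrite mem_iota; lia.
by have /mapP[p _ ->] := h; exists p.
Qed.

Let crossesE d k P : crosses (d, k) P = ((ax d P).1 <= k < (ax d P).2)%R.
Proof. by case: d. Qed.

Let in_rectE d P p : in_rect P (pt p) =
  ((ax d P).1 <= (co d p)%:Z <= (ax d P).2)%R &&
  ((ax (~~ d) P).1 <= (co (~~ d) p)%:Z <= (ax (~~ d) P).2)%R.
Proof. by case: d; rewrite /in_rect //= andbC. Qed.

Let split_costE d k P : split_cost X (d, k) P =
  opp_pairs (fun p => pco d p <= k)%R
    (map pt (sort (relpre (co (~~ d)) leq) [seq p <- enum T | in_rect P (pt p)])).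
Proof.
have e : [seq p <- X | in_rect P p] = map pt [seq p <- enum T | in_rect P (pt p)].
  by rewrite /X filter_map.
rewrite /split_cost e; case: d; rewrite /= sort_map; congr (opp_pairs _ (map _ (sort _ _)));
  by apply/funext => p; apply/funext => q; rewrite /= lez_nat.
Qed.

(** * The cost for a fixed order of the lines *)

Section Order.
Variable s : seq line.
Hypothesis us : uniq s.
Hypothesis mem_s : s =i lines n.

(** The point of coordinate [n] has no line; its index is [size s], after all lines. *)
Let pr d p := index (d, (co d p)%:Z%R) s.

Let prI d : injective (pr d).
Proof.
move=> p q e; apply: (@coI d).
have mem r : ((d, (co d r)%:Z%R) \in s) = (co d r < n).
  rewrite mem_s /lines mem_cat.
  have h : forall d' : bool, ((d', (co d r)%:Z%R) \in [seq (d', Posz i) | i <- iota 0 n]) = (co d r < n).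
    move=> d'; apply/idP/idP => [/mapP[i]|lt]; first by rewrite mem_iota => hi [e']; lia.
    by apply/mapP; exists (co d r) => //; rewrite mem_iota; lia.
  have h' : forall d' : bool, ((d', (co d r)%:Z%R) \in [seq (~~ d', Posz i) | i <- iota 0 n]) = false.
    by move=> d'; apply/negbTE/negP => /mapP[i _ []]; case: d'.
  by case: d {e} h h' => h h'; [rewrite h (h' true) orbF | rewrite (h' false) h].
case: (ltnP (co d p) n) => hp; case: (ltnP (co d q) n) => hq.
- have := congr1 (nth (true, 0%R) s) e; rewrite /pr !nth_index ?mem // => -[]; lia.
- have : index (d, (co d p)%:Z%R) s < size s by rewrite index_mem mem.
  by rewrite -/(pr d p) e ltnNge /pr memNindex ?leqnn // mem; lia.
- have : index (d, (co d q)%:Z%R) s < size s by rewrite index_mem mem.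
  by rewrite -/(pr d q) -e ltnNge /pr memNindex ?leqnn // mem; lia.
- by have := co_range d p; have := co_range d q; lia.
Qed.

(** Each side change is counted at the end that comes first in the order of [y]. *)
Definition starts (x y pr : T -> nat) (m p : T) : bool :=
  `[< (exists r, alternation x y pr true (m, p, r)) \/
      (exists l, alternation x y pr false (m, l, p)) >].

(** The invariant after the lines [s1]: none of them crosses [P], and each side of [P] is on one of
    them or on the bounding box. *)
Definition uncut (s1 : seq line) (P : rect) : Prop :=
  (forall L, L \in s1 -> ~~ crosses L P) /\
  forall d, [/\ (1 <= (ax d P).1)%R, ((ax d P).2 <= n%:Z)%R,
    ((ax d P).1 == 1%R) || ((d, (ax d P).1 - 1)%R \in s1) &
    ((ax d P).2 == n%:Z%R) || ((d, (ax d P).2) \in s1)].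

Lemma split_uncut s1 L P P' : uncut s1 P ->
  P' \in (if crosses L P then split_rect L P else [:: P]) -> uncut (rcons s1 L) P'.
Proof.
case: L => dL k [h1 h2]; case: ifP => [cr|ncr] hP'; last first.
  move: hP'; rewrite mem_seq1 => /eqP ->; split.
    by move=> L; rewrite mem_rcons inE => /predU1P[->|/h1]; rewrite ?ncr.
  move=> d; have [a b c e] := h2 d; split=> //; rewrite mem_rcons inE.
    by case/orP: c => ->; rewrite ?orbT.
  by case/orP: e => ->; rewrite ?orbT.
have [sub ncL] : (forall d, ax d P' = ax d P \/ d = dL /\
    (ax d P' = ((ax d P).1, k) \/ ax d P' = (k + 1, (ax d P).2))%R) /\ ~~ crosses (dL, k) P'.
  case: dL cr hP' => /= cr; rewrite /split_rect /= !inE => /orP[]/eqP ->; split;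
  by [case; tauto | rewrite /crosses /=; lia].
rewrite crossesE in cr; split.
  move=> [d j]; rewrite mem_rcons inE => /predU1P[->//|/h1]; rewrite !crossesE.
  by apply: contra; case: (sub d) => [->|[ed [->|->]]] //=; subst d; lia.
move=> d; have [a b c e] := h2 d; case: (sub d) => [->|[ed he]].
  split=> //; rewrite mem_rcons inE.
    by case/orP: c => ->; rewrite ?orbT.
  by case/orP: e => ->; rewrite ?orbT.
subst d; case: he => ->; split=> //=; rewrite ?mem_rcons ?inE ?eqxx ?orbT //; try lia.
- by case/orP: c => ->; rewrite ?orbT.
- by rewrite GRing.addrK eqxx orbT.
- by case/orP: e => ->; rewrite ?orbT.
Qed.

Lemma split_count L P p :
  count (in_rect^~ p) (if crosses L P then split_rect L P else [:: P]) = in_rect P p :> nat.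
Proof.
case: L P p => d k [[a b] [a' b']] [u v]; case: ifP => //= [cr|_]; last by rewrite addn0.
by case: d cr => /=; rewrite /crosses /in_rect /=; lia.
Qed.

(** Points consecutive in a rectangle are consecutive in the whole slab, so each side change is an
    alternation; the rectangles being disjoint, it is counted once. *)
Lemma step_cost d (m : T) s1 s2 (R : seq rect) :
  s = s1 ++ (d, (co d m)%:Z%R) :: s2 -> (forall P, P \in R -> uncut s1 P) ->
  (forall p, count (in_rect^~ p) R <= 1) ->
  sumn [seq split_cost X (d, (co d m)%:Z%R) P | P <- R & crosses (d, (co d m)%:Z%R) P]
    <= count (starts (co d) (co (~~ d)) (pr d) m) (enum T).
Proof.
move=> es hR cR; set L := (d, _); set st := starts _ _ _ _.
have index_gt L' : L' \notin s1 -> L' != L -> index L s < index L' s.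
  move=> h1 h2; have Ls1 : L \notin s1.
    by move: us; rewrite es cat_uniq /= negb_or => /and3P[_ /andP[]].
  by rewrite es !index_cat (negPf h1) (negPf Ls1) /= eqxx eq_sym (negPf h2); lia.
have index_lt L' : L' \in s1 -> index L' s < index L s.
  move=> h1; have Ls1 : L \notin s1.
    by move: us; rewrite es cat_uniq /= negb_or => /and3P[_ /andP[]].
  by rewrite es !index_cat h1 (negPf Ls1) /= eqxx addn0 index_mem.
have one P : P \in R -> crosses L P ->
    split_cost X L P <= count (fun p => st p && in_rect P (pt p)) (enum T).
  move=> PR; rewrite crossesE => cr; have [ncr /(_ d) [a b c e]] := hR P PR.
  (* A line between the point and [m] would cross [P], so it is not yet processed. *)
  have inc p : in_rect P (pt p) -> cell (co d) (pr d) m p.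
    rewrite (in_rectE d) => /andP[hp _] z hz; apply: index_gt; last first.
      by apply/eqP => -[]; lia.
    by apply/negP => /ncr; rewrite crossesE; lia.
  (* Outside [P], such a point would be separated from [m] by a side of [P], which is a processed
     line. *)
  have inr p q r : in_rect P (pt p) -> in_rect P (pt q) -> cell (co d) (pr d) m r ->
      co (~~ d) p < co (~~ d) r < co (~~ d) q -> in_rect P (pt r).
    rewrite !(in_rectE d) => /andP[_ hp] /andP[_ hq] cr' hr.
    apply/andP; split; last by lia.
    have hrr := co_range d r; have hm := co_range d m.
    apply/andP; split; rewrite Order.TotalTheory.leNgt; apply/negP => lt.
      have ne : (ax d P).1 != 1%R by lia.
      rewrite (negPf ne) /= in c.
      have [|z hz] := @co_surj d `|((ax d P).1 - 1)%R|; first by lia.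
      have ez : (co d z)%:Z%R = ((ax d P).1 - 1)%R by lia.
      have := index_lt _ c; have := cr' z; rewrite /pr ez -/L; lia.
    have ne : (ax d P).2 != n%:Z%R by lia.
    rewrite (negPf ne) /= in e.
    have [|z hz] := @co_surj d `|(ax d P).2|; first by lia.
    have ez : (co d z)%:Z%R = (ax d P).2 by lia.
    have := index_lt _ e; have := cr' z; rewrite /pr ez -/L; lia.
  rewrite split_costE opp_pairs_map.
  set F := [seq p <- _ | _]; set S := sort _ F.
  have -> : count (fun p => st p && in_rect P (pt p)) (enum T) = count st S.
    by rewrite -count_filter; apply/esym/permP; rewrite perm_sort.
  have memS p : (p \in S) = in_rect P (pt p).
    by rewrite mem_sort mem_filter mem_enum andbT.
  have uS : uniq S by rewrite sort_uniq filter_uniq ?enum_uniq.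
  have sS : sorted (relpre (co (~~ d)) ltn) S.
    rewrite -sorted_map ltn_sorted_uniq_leq map_inj_uniq; last exact: coI.
    by rewrite uS sorted_map; apply: sort_sorted => p q; apply: leq_total.
  apply: (@count_zip_behead T (fun p q => (pco d (pt p) <= (co d m)%:Z)%R !=
    (pco d (pt q) <= (co d m)%:Z)%R)) => S1 p q S2 eS; rewrite !pco_pt => sd.
  have [ps qs] : in_rect P (pt p) /\ in_rect P (pt q).
    by rewrite -!memS eS !mem_cat !inE !eqxx !orbT.
  have tr : transitive (relpre (co (~~ d)) ltn) by move=> a1 a2 a3; apply: ltn_trans.
  move: sS; rewrite eS sorted_pairwise // pairwise_cat /= => /and4P[/allrelP h1 _ /andP[pq _] /andP[hq _]].
  have co_ z : cell (co d) (pr d) m z -> ~ (co (~~ d) p < co (~~ d) z < co (~~ d) q).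
    move=> cz hz; have := inr p q z ps qs cz hz; rewrite -memS eS mem_cat => /orP[z1|].
      have := h1 z p z1; rewrite inE eqxx /= => /(_ isT); lia.
    rewrite !inE => /or3P[/eqP|/eqP|/(allP hq)/=]; try (move=> ez; move: hz; rewrite ez; lia).
    by lia.
  apply/asboolP; have cp := inc p ps; have cq := inc q qs.
  rewrite !lez_nat in sd; case: (leqP (co d p) (co d m)) sd => hp sd.
    left; exists q; split=> //; first by lia.
    by move=> z cz; split; [apply: co_ | lia].
  right; exists q; split=> //; first by lia.
  by move=> z cz; split; [lia | apply: co_].
apply: (@leq_trans (\sum_(P <- R) count (fun p => st p && in_rect P (pt p)) (enum T))).
  rewrite sumnE big_map big_filter big_seq_cond [leqRHS](bigID (crosses L)) /=.
  apply: leq_trans (leq_addr _ _); rewrite [leqRHS]big_seq_cond.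
  by apply: leq_sum => P /andP[PR cr]; apply: one.
under eq_bigr do rewrite -sum1_count big_mkcond /=.
rewrite exchange_big /= -sum1_count [leqRHS]big_mkcond; apply: leq_sum => p _.
case: (st p) => /=; last by rewrite big1.
by rewrite -big_mkcond sum1_count; apply: cR.
Qed.

(** Zero for coordinate 0, where the line runs along the border of the bounding box and crosses
    nothing. *)
Let bound (L : line) :=
  \sum_(d : bool) \sum_(m : T) (L == (d, (co d m)%:Z%R)) *
    count (starts (co d) (co (~~ d)) (pr d) m) (enum T).

Lemma gstep_bound s1 s2 R c : s = s1 ++ s2 -> (forall P, P \in R -> uncut s1 P) ->
  (forall p, count (in_rect^~ p) R <= 1) ->
  (foldl (gstep X) (R, c) s2).2 <= c + \sum_(L <- s2) bound L.
Proof.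
elim: s2 s1 R c => [|[d k] s2 IH] s1 R c es hR cR; first by rewrite big_nil addn0.
rewrite /= big_cons addnA; set st := gstep _ _ _.
have hst : st = (st.1, st.2) by case: st.
rewrite hst; apply: leq_trans (IH (rcons s1 (d, k)) _ _ _ _ _) _.
- by rewrite cat_rcons.
- move=> P /flattenP[Q /mapP[P0 P0R ->]]; apply: split_uncut; exact: hR.
- move=> p; rewrite count_flatten -map_comp.
  rewrite (eq_map (g := fun P => in_rect P p : nat)); last by move=> P; exact: split_count.
  by rewrite sumn_count; apply: cR.
rewrite leq_add2r /= leq_add2l.
case: (boolP (has (crosses (d, k)) R)) => [/hasP[P PR]|]; last first.
  by move=> /hasPn h; rewrite (@eq_in_filter _ _ pred0) ?filter_pred0 // => P /h /negPf.
rewrite crossesE => cr; have [_ /(_ d)[a b _ _]] := hR P PR.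
have [|m hm] := @co_surj d `|k|; first by lia.
have ek : k = (co d m)%:Z%R by lia.
rewrite ek in es *; apply: leq_trans (step_cost es hR cR) _.
rewrite /bound (bigD1 d) //= (bigD1 m) //= eqxx mul1n.
by rewrite -addnA leq_addr.
Qed.

(** The factor 4 counts two directions of lines and two kinds of alternations. *)
Lemma cGB_sigma_bound c :
  (forall d b, injective (pr d) ->
     at_most (alternation (co d) (co (~~ d)) (pr d) b) c) ->
  cGB_sigma X s <= 4 * c.
Proof.
move=> hc; have szX : size X = n by rewrite size_map -cardE.
rewrite /cGB_sigma; apply: (leq_trans (@gstep_bound [::] s [:: bbox (size X)] 0 erefl _ _)).
- move=> P; rewrite mem_seq1 => /eqP ->; rewrite szX; split=> // d.
  by case: d; rewrite /= !eqxx.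
- by move=> p /=; case: in_rect.
rewrite add0n exchange_big /=.
have hd d : \sum_(L <- s) \sum_(m : T) (L == (d, (co d m)%:Z%R)) *
    count (starts (co d) (co (~~ d)) (pr d) m) (enum T) <= 2 * c.
  rewrite exchange_big /=.
  apply: (@leq_trans (\sum_(m : T) count (starts (co d) (co (~~ d)) (pr d) m) (enum T))).
    apply: leq_sum => m _; rewrite -big_distrl /= -[leqRHS]mul1n leq_mul2r; apply/orP; right.
    have -> : \sum_(i <- s) (i == (d, (co d m)%:Z%R)) = count_mem (d, (co d m)%:Z%R) s.
      by rewrite -sum1_count [RHS]big_mkcond; apply: eq_bigr => i _ /=; case: eqP.
    by rewrite count_uniq_mem // leq_b1.
  rewrite (eq_bigr (fun m => \sum_(p : T | starts (co d) (co (~~ d)) (pr d) m p) 1)); last first.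
    by move=> m _; rewrite sum1_count /= enumT.
  rewrite pair_big_dep /= sum1_card cardE.
  set D := fun e : T * T => starts (co d) (co (~~ d)) (pr d) e.1 e.2.
  have h : at_most (fun e => D e : Prop) (c + c).
    apply: (at_most_sub _ (at_most_or
      (at_most_image (g := fun e : T * T * T => e.1) (D := fun e => exists r, alternation (co d) (co (~~ d)) (pr d) true (e.1, e.2, r)) _ (hc d true (@prI d)))
      (at_most_image (g := fun e : T * T * T => (e.1.1, e.2)) (D := fun e => exists l, alternation (co d) (co (~~ d)) (pr d) false (e.1, l, e.2)) _ (hc d false (@prI d))))).
    - by move=> e /asboolP.
    - by move=> [m p] [r h]; exists (m, p, r).
    - by move=> [m p] [l h]; exists (m, l, p).
  apply: leq_trans (h _ (enum_uniq _) _) _; last by lia.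
  by move=> e; rewrite mem_enum.
apply: leq_trans (leq_sum _ (fun d _ => hd d)) _.
by rewrite sum_nat_const card_bool; lia.
Qed.

End Order.
End GuillotineCost.

(** * The point set *)

Section Rank.
Local Open Scope nat_scope.
Variables (T : finType) (k : T -> nat).

Definition rank (p : T) : nat := #|[pred z | k z <= k p]|.

Lemma rank_lt p q : (rank p < rank q) = (k p < k q).
Proof.
apply/idP/idP => [|lt].
  apply: contraTT; rewrite -!leqNgt => le; apply: subset_leq_card.
  by apply/subsetP => z; rewrite !inE => /leq_trans; apply.
apply: proper_card; apply/properP; split.
  by apply/subsetP => z; rewrite !inE => /leq_trans; apply; apply: ltnW.
by exists q; rewrite !inE // -ltnNge.
Qed.

Lemma rank_range p : 0 < rank p <= #|T|.
Proof. by rewrite max_card andbT; apply/card_gt0P; exists p; rewrite inE. Qed.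

Hypothesis kI : injective k.

Lemma rank_inj : injective rank.
Proof.
move=> p q e; apply: kI; apply/eqP.
by case: ltngtP => //; rewrite -rank_lt e ltnn.
Qed.

Lemma perm_rank : perm_eq (map rank (enum T)) (iota 1 #|T|).
Proof.
have us : uniq (map rank (enum T)) by rewrite map_inj_uniq ?enum_uniq //; apply: rank_inj.
have sub : {subset map rank (enum T) <= iota 1 #|T|}.
  by move=> a /mapP[p _ ->]; rewrite mem_iota; have := rank_range p; lia.
have sz : size (iota 1 #|T|) <= size (map rank (enum T)) by rewrite size_iota size_map -cardE.
by have [_ e] := uniq_min_size us sub sz; apply: uniq_perm; rewrite ?iota_uniq.
Qed.

(** When the key refines the class, the ranks in a class form an interval; this gives the boxes of
    the blocks. *)
Lemma rank_class (c : T -> nat) p j : (forall z, k z <= k p -> c z <= c p) ->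
  (forall z, c z < c p -> k z <= k p) -> c p = j ->
  #|[pred z | c z < j]| < rank p <= #|[pred z | c z < j.+1]|.
Proof.
move=> h1 h2 <-; apply/andP; split; last first.
  by apply: subset_leq_card; apply/subsetP => z; rewrite !inE ltnS; apply: h1.
apply: proper_card; apply/properP; split.
  by apply/subsetP => z; rewrite !inE; apply: h2.
by exists p; rewrite !inE ?leqnn ?ltnn.
Qed.

End Rank.

(** * The grid of shifted bit-reversal blocks *)

Section Instance.
Local Open Scope nat_scope.
Variable q : nat.
Let N := 2 ^ q.
Let M := 2 ^ N.
Let T : finType := ('I_M * 'I_M * 'I_N)%type.

Lemma bitrev_lt r k : bitrev r k < 2 ^ r.
Proof.
elim: r k => //= r IH k; have p := expnS 2 r.
by case: ifP => _; [have := IH k | have := IH (k - 2 ^ r)]; lia.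
Qed.

Lemma bitrev_surj r c : c < 2 ^ r -> exists2 k, k < 2 ^ r & bitrev r k = c.
Proof.
move=> hc; pose f (k : 'I_(2 ^ r)) := Ordinal (bitrev_lt r k).
have fI : injective f.
  by move=> k k' [e]; apply: val_inj; apply: bitrev_inj e.
have [g _ gK] := injF_bij fI.
by exists (g (Ordinal hc)) => //; have := congr1 val (gK (Ordinal hc)).
Qed.

Let ti (p : T) : nat := p.1.1.
Let tj (p : T) : nat := p.1.2.
Let tk (p : T) : nat := p.2.
Let tr (p : T) : nat := bitrev q (tk p).

(** Mixed-radix code of the lexicographic order on triples. *)
Let key a b c := (a * (M * 2) + b) * M + c.

Let key_lt a b c a' b' c' : b < M * 2 -> b' < M * 2 -> c < M -> c' < M ->
  key a b c < key a' b' c' <-> a < a' \/ a = a' /\ (b < b' \/ b = b' /\ c < c').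
Proof.
have lex u v u' v' K : v < K -> v' < K -> u * K + v < u' * K + v' <-> u < u' \/ u = u' /\ v < v'.
  move=> hv hv'; case: (ltngtP u u') => [h|h|->].
  - have : u.+1 * K <= u' * K by rewrite leq_mul2r h orbT.
    by rewrite mulSn; move: (u * K) (u' * K); lia.
  - have : u'.+1 * K <= u * K by rewrite leq_mul2r h orbT.
    by rewrite mulSn; move: (u * K) (u' * K); lia.
  - by rewrite ltn_add2l; lia.
move=> hb hb' hc hc'; rewrite /key lex //.
have := lex a b a' b' (M * 2) hb hb'; have := lex a' b' a b (M * 2) hb' hb.
lia.
Qed.

Let kx p := key (tj p) (2 ^ (tk p).+1 + ti p) (ti p).
Let ky p := key (ti p) (2 ^ (tr p).+1 + tj p) (tj p).

Let ti_lt p : ti p < M. Proof. exact: ltn_ord. Qed.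
Let tj_lt p : tj p < M. Proof. exact: ltn_ord. Qed.
Let tk_lt p : tk p < N. Proof. exact: ltn_ord. Qed.
Let tr_lt p : tr p < N. Proof. exact: bitrev_lt. Qed.

Let pow_lt k i : k < N -> i < M -> 2 ^ k.+1 + i < M * 2.
Proof.
move=> hk hi; have : 2 ^ k.+1 <= M by rewrite leq_exp2l.
lia.
Qed.

Let x := rank kx.
Let y := rank ky.

Let xlex p z : x p < x z <-> tj p < tj z \/ tj p = tj z /\
  (2 ^ (tk p).+1 + ti p < 2 ^ (tk z).+1 + ti z \/
   2 ^ (tk p).+1 + ti p = 2 ^ (tk z).+1 + ti z /\ ti p < ti z).
Proof. by rewrite /x rank_lt; apply: key_lt; rewrite ?pow_lt. Qed.

Let ylex p z : y p < y z <-> ti p < ti z \/ ti p = ti z /\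
  (2 ^ (tr p).+1 + tj p < 2 ^ (tr z).+1 + tj z \/
   2 ^ (tr p).+1 + tj p = 2 ^ (tr z).+1 + tj z /\ tj p < tj z).
Proof. by rewrite /y rank_lt; apply: key_lt; rewrite ?pow_lt. Qed.

Let tr_eq p z : tr p = tr z -> tk p = tk z.
Proof. by move=> e; apply: bitrev_inj e. Qed.

Let pow_eq a b : (2 ^ a.+1 == 2 ^ b.+1) = (a == b).
Proof. by rewrite eqn_exp2l. Qed.

Let T_eq p z : ti p = ti z -> tj p = tj z -> tk p = tk z -> p = z.
Proof.
case: p z => [[i j] k] [[i' j'] k']; rewrite /ti /tj /tk /= => ei ej ek.
by congr (_, _, _); apply: val_inj.
Qed.

Let kxI : injective kx.
Proof.
move=> p z e; have l1 : kx p < kx z <-> _ := key_lt _ _ (pow_lt (tk_lt p) (ti_lt p)) (pow_lt (tk_lt z) (ti_lt z)) (ti_lt p) (ti_lt z).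
have l2 : kx z < kx p <-> _ := key_lt _ _ (pow_lt (tk_lt z) (ti_lt z)) (pow_lt (tk_lt p) (ti_lt p)) (ti_lt z) (ti_lt p).
rewrite e ltnn in l1; rewrite e ltnn in l2.
have [ei ej eu] : [/\ ti p = ti z, tj p = tj z & 2 ^ (tk p).+1 + ti p = 2 ^ (tk z).+1 + ti z].
  by split; lia.
apply: T_eq => //; apply/eqP; rewrite -pow_eq; apply/eqP; lia.
Qed.

Let kyI : injective ky.
Proof.
move=> p z e; have l1 : ky p < ky z <-> _ := key_lt _ _ (pow_lt (tr_lt p) (tj_lt p)) (pow_lt (tr_lt z) (tj_lt z)) (tj_lt p) (tj_lt z).
have l2 : ky z < ky p <-> _ := key_lt _ _ (pow_lt (tr_lt z) (tj_lt z)) (pow_lt (tr_lt p) (tj_lt p)) (tj_lt z) (tj_lt p).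
rewrite e ltnn in l1; rewrite e ltnn in l2.
have [ei ej eu] : [/\ ti p = ti z, tj p = tj z & 2 ^ (tr p).+1 + tj p = 2 ^ (tr z).+1 + tj z].
  by split; lia.
apply: T_eq => //; apply: tr_eq; apply/eqP; rewrite -pow_eq; apply/eqP; lia.
Qed.

Let cardT : #|T| = M * M * N.
Proof. by rewrite !card_prod !card_ord. Qed.

Let T_ex a b c : a < M -> b < M -> c < N -> exists p : T, [/\ ti p = a, tj p = b & tk p = c].
Proof. by move=> ha hb hc; exists (Ordinal ha, Ordinal hb, Ordinal hc). Qed.

Let pt (p : T) : point := ((x p)%:Z, (y p)%:Z)%R.
Let X := map pt (enum T).

Let sizeX : size X = #|T|. Proof. by rewrite size_map -cardE. Qed.

Let permX : perm_points X #|T|.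
Proof.
split; rewrite -map_comp.
  by rewrite (map_comp Posz x); apply: perm_map; apply: perm_rank.
by rewrite (map_comp Posz y); apply: perm_map; apply: perm_rank.
Qed.

Let cGBX : cGB X <= 84 * #|T|.
Proof.
apply/bigmax_leqP_seq => s; rewrite mem_permutations sizeX => ps _.
have us : uniq s.
  rewrite (perm_uniq ps) /lines cat_uniq !map_inj_uniq ?iota_uniq /=; try by move=> ? ? [].
  by rewrite andbT; apply/hasPn => L /mapP[i _ ->]; apply/negP => /mapP[].
rewrite (_ : 84 * #|T| = 4 * (21 * #|T|)); last by lia.
apply: cGB_sigma_bound; try exact: rank_inj; try exact: rank_range; try exact: us.
  exact: perm_mem.
case=> b prI.
  apply: (@at_most_alternation T x y _ ti tj tk (fun p => 2 ^ (tr p).+1) M N) => //;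
    try exact: rank_inj.
  by move=> p z; rewrite pow_eq; apply/eqP/eqP => [/tr_eq//|e]; rewrite /tr e.
(* For horizontal lines the coordinates are exchanged, and the reversed exponent takes the role of
   [tk]. *)
apply: (@at_most_alternation T y x _ tj ti tr (fun p => 2 ^ (tk p).+1) M N) => //;
  try exact: rank_inj.
- move=> a b' c ha hb /bitrev_surj[k hk <-]; have [p [pi pj pk]] := T_ex hb ha hk.
  by exists p; rewrite /tr pk.
- by move=> p z ej ei /tr_eq ek; apply: T_eq.
- by move=> p z; rewrite pow_eq; apply/eqP/eqP => [e|/tr_eq//]; rewrite /tr e.
Qed.

Let optX Y : satisfied (X ++ Y) -> q * #|T| <= 2 * (#|T| + size (undup Y)).
Proof.
move=> sat; have N0 : 0 < N by rewrite expn_gt0.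
(* [cj j] and [ci i] count the points before a block column or block row, so they delimit the boxes
   in ranks. *)
pose cj j := #|[pred z : T | tj z < j]|; pose ci i := #|[pred z : T | ti z < i]|.
have cj_mono : {homo cj : a b / a <= b}.
  by move=> a b h; apply: subset_leq_card; apply/subsetP => z; rewrite !inE => /leq_trans; apply.
have ci_mono : {homo ci : a b / a <= b}.
  by move=> a b h; apply: subset_leq_card; apply/subsetP => z; rewrite !inE => /leq_trans; apply.
pose box (I : 'I_M * 'I_M) (p : point) :=
  ((cj I.2)%:Z < p.1 <= (cj I.2.+1)%:Z)%R && ((ci I.1)%:Z < p.2 <= (ci I.1.+1)%:Z)%R.
pose f (I : 'I_M * 'I_M) k := pt (I.1, I.2, insubd (Ordinal N0) k).
have fk (k : nat) : k < N -> insubd (Ordinal N0) k = k :> nat by move=> h; rewrite val_insubd h.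
have hx p : cj (tj p) < x p <= cj (tj p).+1.
  by apply: rank_class => // z; rewrite (leqNgt (kx z)) -(rank_lt kx) -/(x _) -/(x _); have := xlex p z; lia.
have hy p : ci (ti p) < y p <= ci (ti p).+1.
  by apply: rank_class => // z; rewrite (leqNgt (ky z)) -(rank_lt ky) -/(y _) -/(y _); have := ylex p z; lia.
have := @blocks_lower_bound _ box f q X Y _ _ _ _ _ sat.
rewrite sizeX card_prod !card_ord cardT => h.
rewrite mulnC -mulnA (mulnC N); apply: h.
- by move=> I p p' r; rewrite /box /in_box; lia.
- move=> [i j] [i' j'] p; rewrite /box /= => /andP[a b] /andP[a' b']; congr (_, _); apply: val_inj.
    case: (ltngtP i i') => // lt; [have := ci_mono _ _ lt | have := ci_mono _ _ lt]; lia.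
  case: (ltngtP j j') => // lt; [have := cj_mono _ _ lt | have := cj_mono _ _ lt]; lia.
- move=> [i j] k hk; split; first by apply: map_f; rewrite mem_enum.
  have := hx (i, j, insubd (Ordinal N0) k); have := hy (i, j, insubd (Ordinal N0) k).
  by rewrite /box /f /pt /ti /tj /=; lia.
- move=> [i j] k k' lt hk'; rewrite ltz_nat; apply/xlex; right; split=> //; left.
  by rewrite /tk /ti /= !fk ?ltn_add2r ?ltn_exp2l //; apply: ltn_trans hk'.
- move=> [i j] k k' hk hk' lt; rewrite ltz_nat; apply/ylex; right; split=> //; left.
  by rewrite /tr /tk /tj /= !fk ?ltn_add2r ?ltn_exp2l.
Qed.

Lemma separation_nat : let n := 2 ^ (q + 2 * 2 ^ q) in exists X : seq point,
  [/\ perm_points X n, exists2 m, is_opt X m & q * n <= 2 * (n + m) & cGB X <= 84 * n].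
Proof.
have -> : 2 ^ (q + 2 * 2 ^ q) = #|T|.
  by rewrite cardT /M expnD mul2n -addnn expnD mulnC.
exists X; split=> //; have [m hm] := opt_ex X; exists m => //.
by have [[Y [<- sat]] _] := hm; apply: optX.
Qed.

End Instance.

(** * Iterated logarithms of the number of points *)

Section Logarithms.
Local Open Scope R_scope.

Lemma ln_le_mono a b : 0 < a -> a <= b -> ln a <= ln b.
Proof.
by move=> a0 /Rle_lt_or_eq_dec[lt|->]; [apply/Rlt_le/ln_increasing | apply: Rle_refl].
Qed.

Lemma INR_exp2 e : INR (2 ^ e)%N = 2 ^ e.
Proof. by elim: e => // e IH; rewrite expnS mult_INR IH. Qed.

Lemma ln2_bounds : / 2 <= ln 2 <= 1.
Proof.
have l := ln_lt_2; have e := exp_ineq1 1; split; first lra.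
by rewrite -[X in _ <= X]ln_exp; apply: ln_le_mono; lra.
Qed.

(** [ln n] lies between [2 ^ q] and [4 * 2 ^ q]. A constant lower bound on the triple logarithm
    suffices because the guillotine cost is linear. *)
Lemma iterated_ln_bounds q (n := INR (2 ^ (q + 2 * 2 ^ q))%N) : (4 <= q)%N ->
  ln (ln n) <= 2 * INR q /\ / 2 <= ln (ln (ln n)).
Proof.
move=> q4; have [l1 l2] := ln2_bounds; set Q := INR q; set P := 2 ^ q.
have Q4 : 4 <= Q by have := le_INR 4 q; rewrite /Q /=; move/leP: q4 => q4 /(_ q4); lra.
have QP : Q <= P by rewrite /Q /P -INR_exp2; apply/le_INR/leP/ltnW/ltn_expl.
have P0 : 0 < P by apply: pow_lt; lra.
have en : ln n = (Q + 2 * P) * ln 2.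
  by rewrite /n INR_exp2 ln_pow ?plus_INR ?mult_INR ?INR_exp2; [rewrite -/P /Q /=; lra | lra].
have lP : ln P = Q * ln 2 by rewrite ln_pow //; lra.
have up : ln n <= 2 * (2 * P) by rewrite en; nra.
have lo : P <= ln n by rewrite en; nra.
split.
  have n0 : 0 < ln n by lra.
  apply: Rle_trans (ln_le_mono n0 up) _.
  rewrite !ln_mult ?lP; try lra; nra.
have h : 2 <= ln (ln n).
  by apply: Rle_trans (ln_le_mono P0 lo); rewrite lP; nra.
by apply: Rle_trans l1 (ln_le_mono _ h); lra.
Qed.

(** For [q >= 4] the optimum is at least [(q / 2 - 1) * n >= q * n / 4], and [ln (ln n) <= 2 * q]
    gives [/ 8]; the constant 168 is 84 divided by the bound [/ 2]. *)
Lemma separation_R (n' : nat) : exists (n : nat) (X : seq point),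
  [/\ (n' <= n)%N, perm_points X n,
    exists2 m, is_opt X m & / 8 * INR n * ln (ln (INR n)) <= INR m &
    INR (cGB X) <= 168 * INR n * ln (ln (ln (INR n)))].
Proof.
pose q := maxn n' 4; have q4 : (4 <= q)%N by rewrite leq_maxr.
have [X [pX [m hm lb] ub]] := separation_nat q.
have [h1 h2] := iterated_ln_bounds q4.
have n'n : (n' <= 2 ^ (q + 2 * 2 ^ q))%N.
  apply: leq_trans (ltnW (ltn_expl _ (isT : 1 < 2)%N)).
  by apply: leq_trans (leq_maxl n' 4) (leq_addr _ _).
move: h1 h2 lb ub pX n'n; set n := (2 ^ _)%N => h1 h2 lb ub pX n'n.
have n0 := pos_INR n; exists n, X; split=> //.
  exists m => //; move/leP/le_INR: lb; rewrite !mult_INR plus_INR /= => lb.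
  have Q4 : 4 <= INR q by have := le_INR 4 q; rewrite /=; move/leP: q4 => q4 /(_ q4); lra.
  have : / 8 * INR n * ln (ln (INR n)) <= / 8 * INR n * (2 * INR q).
    by apply: Rmult_le_compat_l h1; nra.
  by nra.
move/leP/le_INR: ub; rewrite mult_INR (INR_IZR_INZ 84) /= => ub.
have : 168 * INR n * / 2 <= 168 * INR n * ln (ln (ln (INR n))).
  by apply: Rmult_le_compat_l h2; nra.
by lra.
Qed.

Lemma constants_gt0 : 0 < / 8 /\ 0 < 168.
Proof. lra. Qed.

End Logarithms.

Import Order.TTheory GRing.Theory Num.Theory.
Local Open Scope ring_scope.

Theorem theorem1p2 :
  exists c1 c2 : R, 0 < c1 /\ 0 < c2 /\
  forall n' : nat, exists (n : nat) (X : seq point),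
    leq n' n /\ perm_points X n /\
    (exists m : nat, is_opt X m /\ c1 * n%:R * ln (ln n%:R) <= m%:R) /\
    (cGB X)%:R <= c2 * n%:R * ln (ln (ln n%:R)).
Proof.
have [c1 c2] := constants_gt0.
exists (Rinv (IZR 8)), (IZR 168); split; first exact/RltP.
split=> [|n']; first exact/RltP.
have [n [X [n'n pX [m hm lb] ub]]] := separation_R n'.
exists n, X; split=> //; split=> //; rewrite -!INRE; split; last exact/RleP.
by exists m; split=> //; rewrite -INRE; apply/RleP.
Qed.
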